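(* Let $\mathbb P^h$ and $\mathbb P^g$ be the measures on $\mathcal F_T$ with $d\mathbb P^h|_{\mathcal F_T}=E^h_T\,d\mathbb P|_{\mathcal F_T}$ and $d\mathbb P^g|_{\mathcal F_T}=E^g_T\,d\mathbb P|_{\mathcal F_T}$, with $E^h,E^g$ as defined in the context, and let $\mathcal L^h(X)$ and $\mathcal L^g(X)$ denote the laws of $X$ on $C([0,T];H)$ under $\mathbb P^h$ and $\mathbb P^g$, respectively. Then $\mathcal L^h(X)$ is absolutely continuous with respect to $\mathcal L^g(X)$ with Radon–Nikodym derivative $$\frac{d\mathcal L^h(X)}{d\mathcal L^g(X)}(X)=\frac{C^g}{C^h}\exp\Big(\int_0^T\langle F(s,X_s),G(s,X_s)\rangle\,ds\Big).$$
   Context: Setting. $H$ is a real separable Hilbert space with inner product $\langle\cdot,\cdot\rangle$. $A$ generates a strongly continuous semigroup $(S_t)_{t\ge0}$ on $H$, $F:[0,\infty)\times H\to H$ is continuous, $Q$ is a symmetric, positive, trace class operator on $H$, $W$ is a cylindrical Wiener process on $H$ on a stochastic basis $(\Omega,\mathcal F,(\mathcal F_t)_{t\ge0},\mathbb P)$, and $\mu_0$ is a Borel probability measure on $H$. It is assumed that $dX_t=[AX_t+F(t,X_t)]dt+Q^{1/2}dW_t$, $X_0\sim\mu_0$, has a unique mild solution $X$; $X$ is a predictable $H$-valued Markov process with almost surely continuous paths and transition kernel $\mu_{s,t}(x,B)=\mathbb P(X_t\in B\mid X_s=x)$. Observations. $0=t_0<t_1<\dots<t_n=T$; $L:H\to\mathbb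 R^m$ bounded linear; $\Sigma\in\mathbb R^{m\times m}$ symmetric positive definite; $f(\cdot;b,C)$ is the Gaussian density with mean $b$ and covariance matrix $C$; $k(x,y):=f(y;Lx,\Sigma)$; $y_1,\dots,y_n\in\mathbb R^m$ are fixed observations. Auxiliary kernel. $(a_t)_{t\ge0}$ is an $H$-valued (deterministic, measurable) function, integrable on bounded intervals; $\nu_{s,t}(x,\cdot)$, $s\le t$, is the Gaussian measure on $H$ with mean $S_{t-s}x+\int_s^tS_{t-u}a_u\,du$ and covariance operator $\int_0^{t-s}S_uQS_u^*\,du$ (the transition kernel of the Ornstein–Uhlenbeck process $dZ_t=[AZ_t+a_t]dt+Q^{1/2}dW_t$). Definitions. For $t\in(t_{i-1},t_i]$, $x\in H$, $$h(t,x):=\int k(x_{t_i},y_i)\Big(\prod_{j=i}^{n-1}k(x_{t_{j+1}},y_{j+1})\,\mu_{t_j,t_{j+1}}(x_{t_j},dx_{t_{j+1}})\Big)\mu_{t,t_i}(x,dx_{t_i}),$$ and $g(t,x)$ is defined by the same formula with $\mu$ replaced by $\nu$; $h(0,x):=\lim_{s\downarrow0}h(s,x)$, $g(0,x):=\lim_{s\downarrow0}g(s,x)$. $G(t,x):=D_x\log g(t,x)\in H$ (Fréchet derivative in $x$). $C^h:=\mathbb E[h(0,X_0)]$, $C^g:=\mathbb E[g(0,X_0)]$. For $t\in(t_{i-1},t_i]$, $$E^h_t:=\frac1{C^h}\Big(\prod_{j=1}^{i-1}k(X_{t_j},y_j)\Big)h(t,X_t),$$ $$E^g_t:=\frac1{C^g}\Big(\prod_{j=1}^{i-1}k(X_{t_j},y_j)\Big)g(t,X_t)\exp\Big(-\int_0^t\langle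 F(s,X_s),G(s,X_s)\rangle ds\Big),$$ with $E^h_0:=h(0,X_0)/C^h$, $E^g_0:=g(0,X_0)/C^g$. Both $E^h$ and $E^g$ are non-negative $\mathbb P$-martingales with mean one, so $\mathbb P^h$ and $\mathbb P^g$ are probability measures. *)

(* Defs.v *)
From HB Require Import structures.
From mathcomp Require Import all_boot all_order all_algebra.
From mathcomp Require Import all_classical all_reals all_analysis.

Set Implicit Arguments.
Unset Strict Implicit.
Unset Printing Implicit Defensive.

Import Order.TTheory GRing.Theory Num.Theory.
Import numFieldNormedType.Exports.

Local Open Scope classical_set_scope.
Local Open Scope ring_scope.

(* A real separable Hilbert space is a [completeNormedModType R] together with an inner product
   [dot] inducing its norm and a countable dense subset.  Processes and
   semigroups are functions on [R] of which only the values at times [0 <= t]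
   matter. *)

Notation borel V := (g_sigma_algebraType (@open V)).

Section hilbert.
Context {R : realType} {H : completeNormedModType R}.
Implicit Type dot : H -> H -> R.

Record inner_product dot : Prop := {
  dot_sym : forall x y, dot x y = dot y x ;
  dot_lin : forall a x y z, dot (a *: x + y) z = a * dot x z + dot y z ;
  dot_norm : forall x, dot x x = `|x| ^+ 2 }.

Definition separable := exists D : set H, countable D /\ dense D.

(* The adjoint of a bounded operator; it exists by the Riesz theorem. *)
Definition adjoint dot (B : H -> H) (y : H) : H :=
  xget 0 [set z | forall x, dot (B x) y = dot x z].

Definition symmetric_positive dot (B : H -> H) : Prop :=
  (forall x y, dot (B x) y = dot x (B y)) /\ (forall x, 0 <= dot (B x) x).

Definition orthonormal_basis dot (B : set H) : Prop :=
  [/\ forall e, B e -> dot e e = 1,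
      forall e f, B e -> B f -> e <> f -> dot e f = 0
    & forall x, (forall e, B e -> dot x e = 0) -> x = 0].

(* For a positive operator the trace does not depend on the basis. *)
Definition trace_class_positive dot (B : H -> H) : Prop :=
  exists2 E : set H, orthonormal_basis dot E &
    (\esum_(e in E) (dot (B e) e)%:E < +oo)%E.

Record C0_semigroup (S : R -> {linear H -> H}) : Prop := {
  semigroup_bounded : forall t, 0 <= t -> continuous (S t) ;
  semigroup0 : forall x, S 0 x = x ;
  semigroupD : forall s t, 0 <= s -> 0 <= t ->
    forall x, S (s + t) x = S s (S t x) ;
  semigroup_cvg : forall x, S t x @[t --> 0^'+] --> x }.

(* The values of [A] outside its domain [DA] are irrelevant. *)
Definition generator (DA : set H) (A : H -> H) (S : R -> {linear H -> H}) :=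
  forall x y : H, (DA x /\ A x = y) <->
    (t^-1 *: (S t x - x) @[t --> 0^'+] --> y).

(* [I] is the Bochner integral of [f] over [a, b]: as [H] is separable, a Borel
   measurable [f] with integrable norm is Bochner integrable, and its integral
   is determined by its inner products. *)
Definition bochner_integral dot (a b : R) (f : R -> H) (I : H) : Prop :=
  [/\ measurable_fun `[a, b] (f : R -> borel H),
      lebesgue_measure.-integrable `[a, b] (fun u : R => (`|f u|)%:E)
    & forall v, dot I v = \int[lebesgue_measure]_(u in `[a, b]) dot (f u) v].

(* The normal law on R with mean [m] and variance [v]; the library's
   [normal_prob] takes the standard deviation and is not the Dirac mass at [m]
   when that is 0. *)
Definition normal_law (m v : R) (B : set R) : \bar R :=
  if v == 0 then \d_m B else normal_prob m (Num.sqrt v) B.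

Definition gaussian_measure dot (nu : probability (borel H) R)
    (m : H) (C : H -> H) : Prop :=
  forall (v : H) (B : set R), measurable B ->
    nu [set z : H | B (dot z v)] = normal_law (dot m v) (dot (C v) v) B.

Definition OU_kernel dot (S : R -> {linear H -> H}) (Q : H -> H) (a : R -> H)
    (nu : R -> R -> H -> probability (borel H) R) : Prop :=
  forall s t, 0 <= s <= t ->
  exists m : H, exists C : H -> H,
    [/\ bochner_integral dot s t (fun u => S (t - u) (a u)) m,
        forall v, bochner_integral dot 0 (t - s)
          (fun u => S u (Q (adjoint dot (S u) v))) (C v)
      & forall x, gaussian_measure dot (nu s t x) (S (t - s) x + m) C].

Definition gradient dot (phi : H -> R) (x v : H) : Prop :=
  is_diff x phi (dot v).

End hilbert.

Section stochastic.
Context {R : realType} {H : completeNormedModType R}.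
Context {d : measure_display} {Omega : measurableType d}.
Variables (dot : H -> H -> R) (P : probability Omega R).
Variable Filt : R -> set (set Omega).

Record filtration : Prop := {
  filtration_sigma : forall t, 0 <= t -> sigma_algebra setT (Filt t) ;
  filtration_sub : forall t, 0 <= t -> Filt t `<=` measurable ;
  filtration_homo : forall s t, 0 <= s <= t -> Filt s `<=` Filt t }.

(* [W t v] stands for <W_t, v>.  The increment clause says that
   <W_t - W_s, v> is independent of F_s with law N(0, (t - s) |v|^2). *)
Record cylindrical_wiener (W : R -> H -> Omega -> R) : Prop := {
  wiener_adapted : forall t v, 0 <= t ->
    forall B, measurable B -> Filt t (W t v @^-1` B) ;
  wiener0 : forall v, {ae P, forall w, W 0 v w = 0} ;
  wiener_linear : forall t c u v, 0 <= t ->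
    {ae P, forall w, W t (c *: u + v) w = c * W t u w + W t v w} ;
  wiener_increment : forall s t v, 0 <= s -> s < t ->
    forall (A : set Omega) (B : set R), Filt s A -> measurable B ->
    P (A `&` [set w | B (W t v w - W s v w)])
    = (P A * normal_law 0 ((t - s) * `|v| ^+ 2) B)%E ;
  wiener_continuous : forall v,
    {ae P, forall w, {within `[0, +oo[, continuous (fun t => W t v w)}} }.

(* A deterministic step integrand, the sum of the 1_(a, b] v over the [(a, b, v)]
   in the list, and its integral against [W]. *)
Definition step_fun (s : seq (R * R * H)) (u : R) : H :=
  \sum_(p <- s) (if p.1.1 < u <= p.1.2 then p.2 else 0).

Definition step_integral (W : R -> H -> Omega -> R) (s : seq (R * R * H))
    (w : Omega) : R :=
  \sum_(p <- s) (W p.1.2 p.2 w - W p.1.1 p.2 w).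

(* [J] is the Wiener integral of <phi(u), dW_u> over [0, t], the extension by
   isometry of [step_integral]. *)
Definition wiener_integral (W : R -> H -> Omega -> R) (t : R) (phi : R -> H)
    (J : Omega -> R) : Prop :=
  [/\ measurable_fun `[0, t] (phi : R -> borel H), measurable_fun setT J &
  exists s : nat -> seq (R * R * H),
    [/\ forall k, {in s k, forall p, 0 <= p.1.1 <= p.1.2 /\ p.1.2 <= t},
        (\int[lebesgue_measure]_(u in `[0%R, t])
           (`|phi u - step_fun (s k) u| ^+ 2)%:E)%E @[k --> \oo] --> 0%E
      & (\int[P]_w ((J w - step_integral W (s k) w) ^+ 2)%:E)%E
          @[k --> \oo] --> 0%E]].

(* [Z] is the H-valued stochastic integral of S_(t-u) Q^(1/2) dW_u over [0, t]:
   its inner product with [v] integrates (S_(t-u) Q^(1/2))^* v. *)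
Definition stochastic_convolution (S : R -> {linear H -> H}) (Qh : H -> H)
    (W : R -> H -> Omega -> R) (t : R) (Z : Omega -> H) : Prop :=
  measurable_fun setT (Z : Omega -> borel H) /\
  forall v, wiener_integral W t (fun u => Qh (adjoint dot (S (t - u)) v))
              (fun w => dot (Z w) v).

(* The predictable sigma-algebra on [0, oo) x Omega. *)
Definition predictable_sets : set (set (R * Omega)) :=
  <<s [set p : R * Omega | 0 <= p.1],
      [set E | (exists s t A, [/\ 0 <= s, s <= t, Filt s A &
                  E = [set p : R * Omega | s < p.1 <= t /\ A p.2]]) \/
               (exists A, Filt 0 A /\
                  E = [set p : R * Omega | p.1 = 0 /\ A p.2])] >>.

Definition predictable (X : R -> Omega -> H) : Prop :=
  forall B : set (borel H), measurable B ->
    predictable_sets [set p : R * Omega | 0 <= p.1 /\ B (X p.1 p.2)].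

Record mild_solution (S : R -> {linear H -> H}) (F : R -> H -> H)
    (Qh : H -> H) (W : R -> H -> Omega -> R) (X : R -> Omega -> H) : Prop := {
  mild_predictable : predictable X ;
  mild_continuous :
    {ae P, forall w, {within `[0, +oo[, continuous (fun t => X t w)}} ;
  mild_equation : forall t, 0 <= t -> exists I Z : Omega -> H,
    [/\ {ae P, forall w, bochner_integral dot 0 t
                 (fun u => S (t - u) (F u (X u w))) (I w)},
        stochastic_convolution S Qh W t Z
      & {ae P, forall w, X t w = S t (X 0 w) + I w + Z w}] }.

(* [X] is a Markov process with respect to the filtration, and
   mu_(s,t)(X_s, B) is a version of P(X_t in B | F_s) = P(X_t in B | X_s). *)
Definition markov_transition (X : R -> Omega -> H)
    (mu : R -> R -> R.-pker (borel H) ~> (borel H)) : Prop :=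
  forall s t, 0 <= s <= t ->
  forall (A : set Omega) (B : set (borel H)), Filt s A -> measurable B ->
    P (A `&` X t @^-1` B) = (\int[P]_(w in A) mu s t (X s w) B)%E.

Record martingale (T : R) (E : R -> Omega -> R) : Prop := {
  martingale_adapted : forall t, 0 <= t <= T ->
    forall B, measurable B -> Filt t (E t @^-1` B) ;
  martingale_integrable : forall t, 0 <= t <= T ->
    P.-integrable setT (EFin \o E t) ;
  martingale_cond : forall s t, 0 <= s -> s <= t -> t <= T ->
    forall A, Filt s A ->
    (\int[P]_(w in A) (E t w)%:E = \int[P]_(w in A) (E s w)%:E)%E }.

Definition density_process (T : R) (E : R -> Omega -> R) : Prop :=
  [/\ martingale T E,
      forall t, 0 <= t <= T -> {ae P, forall w, 0 <= E t w}
    & forall t, 0 <= t <= T -> ('E_P[E t] = 1)%E].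

(* [PT] is the measure on F_T with density [E T] with respect to [P]. *)
Definition has_density (T : R) (E : R -> Omega -> R)
    (PT : probability (g_sigma_algebraType (Filt T)) R) : Prop :=
  forall A, Filt T A -> PT A = (\int[P]_(w in A) (E T w)%:E)%E.

End stochastic.

Section observations.
Context {R : realType} {H : completeNormedModType R} {m : nat}.

Definition spd (Sigma : 'M[R]_m) : Prop :=
  Sigma^T = Sigma /\
  forall v : 'cV[R]_m, v != 0 -> 0 < (v^T *m Sigma *m v) 0 0.

Definition gauss_density (y b : 'cV[R]_m) (C : 'M[R]_m) : R :=
  (Num.sqrt ((2 * pi) ^+ m * \det C))^-1 *
  expR (- 2^-1 * ((y - b)^T *m invmx C *m (y - b)) 0 0).

(* [n] observations [y 1, .., y n], taken at the times [tt 1, .., tt n]. *)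
Variables (k : H -> 'cV[R]_m -> R) (n : nat).
Variables (tt : nat -> R) (y : nat -> 'cV[R]_m).

(* The index [i] such that [t] lies in (t_(i-1), t_i] (and 0 for [t = 0]). *)
Definition obs_index (t : R) : nat :=
  find (fun j => t <= tt j) (iota 0 n.+1).

Section transform.
Variable kappa : R -> R -> H -> {measure set (borel H) -> \bar R}.

(* The iterated integral over the [l] observations following [t_i], the process
   being at [x] at time [t_i]. *)
Fixpoint lookahead (l i : nat) (x : H) : R :=
  if l is l'.+1 then
    \int[kappa (tt i) (tt i.+1) x]_z (k z (y i.+1) * lookahead l' i.+1 z)
  else 1.

Definition transform_pos (t : R) (x : H) : R :=
  let i := obs_index t in
  \int[kappa t (tt i) x]_z (k z (y i) * lookahead (n - i) i z).

(* The functions [h] (for [kappa = mu]) and [g] (for [kappa = nu]). *)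
Definition transform (t : R) (x : H) : R :=
  if t == 0 then lim (transform_pos s x @[s --> 0^'+]) else transform_pos t x.

End transform.

Section weights.
Context {d : measure_display} {Omega : measurableType d}.
Variable X : R -> Omega -> H.

Definition norm_const (P : probability Omega R) (u : R -> H -> R) : R :=
  fine 'E_P[fun w => u 0 (X 0 w)].

Definition weight_h (C : R) (h : R -> H -> R) (t : R) (w : Omega) : R :=
  C^-1 * (\prod_(1 <= j < obs_index t) k (X (tt j) w) (y j)) * h t (X t w).

Definition weight_g (dot : H -> H -> R) (F G : R -> H -> H) (C : R)
    (g : R -> H -> R) (t : R) (w : Omega) : R :=
  C^-1 * (\prod_(1 <= j < obs_index t) k (X (tt j) w) (y j)) * g t (X t w) *
  expR (- \int[lebesgue_measure]_(s in `[0, t])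
            dot (F s (X s w)) (G s (X s w))).

End weights.
End observations.

(* C([0, T]; H) with the topology of uniform convergence. *)
Section paths.
Import ArrowAsUniformType.
Context {R : realType}.
Variables (H : completeNormedModType R) (T : R).

Definition path_space : Type := continuousType (set_type `[0, T]) H.

HB.instance Definition _ :=
  Uniform.copy path_space (continuousType (set_type `[0, T]) H).
HB.instance Definition _ := isPointed.Build path_space
  (mkcts (@cst_continuous (set_type `[0, T]) H 0)).

End paths.

(* The value at time [s] of a path, set to 0 outside [0, T]. *)
Definition path_at {R : realType} {H : completeNormedModType R} {T : R}
    (x : path_space H T) (s : R) : H :=
  valL_ 0 (x : continuousType (set_type `[0, T]) H) s.

(* Main.v *)
Require Import Defs.
From HB Require Import structures.
From mathcomp Require Import all_boot all_order all_algebra.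
From mathcomp Require Import all_classical all_reals all_analysis.
From mathcomp Require Import measurable_realfun ring lra.

(* The observation times end at T, so only the weights at time T enter: there
   mu_(T,T)(X_T, .) and nu_(T,T)(X_T, .) are Dirac masses (the former almost
   surely), hence h(T, X_T) and g(T, X_T) both equal k(X_T, y_n) and
     E^h_T = C^g / C^h * exp (int_0^T <F, G> ds) * E^g_T   almost surely.
   Writing the exponential as phi(X) and pushing forward along X gives
   L^h(X)(B) = int_B phi dL^g(X) for every Borel set B.

   The substance is that phi is a Borel function on the path space.  The
   gradient G is a limit of difference quotients of ln g, which is continuous
   in space because it is differentiable; so it suffices that g is measurable
   in time for each fixed point.  The kernels nu are known only through their
   one-dimensional Gaussian marginals, which depend measurably on the
   parameters; this determines the integrals of trigonometric polynomials, and
   by bounded limits and Dynkin's lemma the values on all Borel sets. *)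

Set Implicit Arguments.
Unset Strict Implicit.
Unset Printing Implicit Defensive.

Import Order.TTheory GRing.Theory Num.Theory.
Import numFieldNormedType.Exports.

Local Open Scope classical_set_scope.
Local Open Scope ring_scope.
Local Open Scope charge_scope.

(** * Inner products and Borel sets of a separable Hilbert space *)

Section inner_product_theory.
Context {R : realType} {H : completeNormedModType R} {dot : H -> H -> R}.
Hypothesis Hdot : inner_product dot.

Let dotC x y : dot x y = dot y x. Proof. exact: dot_sym. Qed.

Lemma dotDl x y z : dot (x + y) z = dot x z + dot y z.
Proof. by have := dot_lin Hdot 1 x y z; rewrite scale1r mul1r. Qed.

Lemma dot0l z : dot 0 z = 0.
Proof.
have := dotDl 0 0 z; rewrite addr0 => /eqP.
by rewrite -subr_eq0 opprD addNKr oppr_eq0 => /eqP.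
Qed.

Lemma dotZl a x z : dot (a *: x) z = a * dot x z.
Proof. by have := dot_lin Hdot a x 0 z; rewrite !addr0 dot0l addr0. Qed.

Lemma dotNl x z : dot (- x) z = - dot x z.
Proof. by rewrite -scaleN1r dotZl mulN1r. Qed.

Lemma dotBl x y z : dot (x - y) z = dot x z - dot y z.
Proof. by rewrite dotDl dotNl. Qed.

Lemma dotDr x y z : dot x (y + z) = dot x y + dot x z.
Proof. by rewrite !(dotC x) dotDl. Qed.

Lemma dotZr a x z : dot x (a *: z) = a * dot x z.
Proof. by rewrite !(dotC x) dotZl. Qed.

Lemma dotBr x y z : dot x (y - z) = dot x y - dot x z.
Proof. by rewrite !(dotC x) dotBl. Qed.

Lemma dot_cauchy_schwarz x y : `|dot x y| <= `|x| * `|y|.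
Proof.
have [->|y0] := eqVneq y 0; first by rewrite dotC dot0l !normr0 mulr0.
have y2 : 0 < `|y| ^+ 2 by rewrite exprn_gt0// normr_gt0.
(* The vector is the component of [x] orthogonal to [y]. *)
have : 0 <= `|x - (dot x y / `|y| ^+ 2) *: y| ^+ 2 by rewrite exprn_ge0.
rewrite -(dot_norm Hdot) dotBl !dotBr !dotZl !dotZr (dotC y x) !(dot_norm Hdot).
set n := `|y| ^+ 2 in y2 *; set c := dot x y.
rewrite (_ : _ - _ = `|x| ^+ 2 - c ^+ 2 / n); last by field; rewrite gt_eqF.
rewrite subr_ge0 ler_pdivrMr// /n -exprMn => h.
rewrite -(@ler_pXn2r _ 2)// ?nnegrE// ?mulr_ge0//.
by rewrite real_normK// num_real.
Qed.

Lemma dot_continuous v : continuous (dot^~ v).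
Proof.
move=> x; apply/cvgrPdist_le => e e0; near=> z.
rewrite -dotBl (le_trans (dot_cauchy_schwarz _ _))//.
have v0 : 0 < `|v| + 1 by rewrite ltr_wpDl.
rewrite (@le_trans _ _ (`|x - z| * (`|v| + 1)))//.
  by rewrite ler_wpM2l// lerDl.
rewrite -ler_pdivlMr//; near: z.
by apply: cvgr_dist_le; [exact: cvg_id|rewrite divr_gt0].
Unshelve. all: by end_near. Qed.

End inner_product_theory.

Lemma separable_dense_seq {R : realType} {H : completeNormedModType R} :
  @separable R H -> exists e : nat -> H,
    forall (x : H) (r : R), 0 < r -> exists j, `|x - e j| < r.
Proof.
move=> [D [cD dD]].
have D0 : D !=set0.
  by have [] := dD setT; [exists 0 | exact: openT | move=> z [_ Dz]; exists z].
have /pcard_surjP[f fD] := cD.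
exists f => x r r0.
have [] := dD (ball x r); first by exists x; exact: ballxx.
  exact: ball_open.
by move=> z [xz /fD[j _ fj]]; exists j; rewrite fj; move: xz; rewrite -ball_normE.
Qed.

Section borel_measurability.
Context {R : realType}.

Lemma continuous_borel_measurable {V : completeNormedModType R} (f : V -> R) :
  continuous f -> measurable_fun [set: borel V] f.
Proof.
move=> /continuousP cf; apply: (measurability _ (RGenOInfty.measurableE R)).
move=> _ [_ [a ->] <-]; rewrite setTI; apply: sub_sigma_algebra.
exact/cf/interval_open.
Qed.

(** Countable gluing. The label [N] will be a discretised time, the index of a nearby dense point,
    or the index of the current observation interval. *)
Lemma measurable_fun_glue {d d'} {T : measurableType d} {T' : measurableType d'}
    (D : set T) (N : T -> nat) (f : nat -> T -> T') :
  (forall j, measurable (D `&` N @^-1` [set j])) ->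
  (forall j, measurable_fun (D `&` N @^-1` [set j]) (f j)) ->
  measurable_fun D (fun t => f (N t) t).
Proof.
move=> mN mf mD B mB.
rewrite (_ : _ `&` _ = \bigcup_j (D `&` N @^-1` [set j] `&` f j @^-1` B)).
  apply: bigcup_measurable => j _; exact: (mf j (mN j) B mB).
apply/seteqP; split=> t /=; first by move=> [Dt Bt]; exists (N t).
by move=> [j _ [[Dt /= <-] Bt]].
Qed.

End borel_measurability.

Section hilbert_borel.
Context {R : realType} {H : completeNormedModType R} {dot : H -> H -> R}.
Hypotheses (Hdot : inner_product dot) (Hsep : @separable R H).

Lemma measurable_dot v : measurable_fun [set: borel H] (fun z => dot z v).
Proof. exact: (continuous_borel_measurable (dot_continuous Hdot (v := v))). Qed.

(** Writes a closed ball as a countable intersection of half-spaces. For the converse, [w] is tested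
    against some [e j] close to [w] itself, which nearly attains the norm. *)
Lemma norm_le_dense (e : nat -> H)
    (eD : forall x r, 0 < r -> exists j, `|x - e j| < r) (w : H) (q : R) :
  0 <= q -> `|w| <= q <-> forall i, dot w (e i) <= q * `|e i|.
Proof.
move=> q0; split=> [wq i|wq].
  rewrite (le_trans (ler_norm _))// (le_trans (dot_cauchy_schwarz Hdot _ _))//.
  by rewrite ler_wpM2r.
have [->|w0] := eqVneq w 0; first by rewrite normr0.
have nw : 0 < `|w| by rewrite normr_gt0.
rewrite -(ler_pM2r nw) -expr2 -(dot_norm Hdot).
apply/ler_addgt0Pr => eps eps0.
(* With [e j] within delta of [w], the square of the norm of [w] is at most [|w|] delta + q ([|w|] +
   delta); this delta makes the excess over q [|w|] equal to [eps]. *)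
have d0 : 0 < eps / (`|w| + q) by rewrite divr_gt0// ltr_wpDr.
have [j wj] := eD w _ d0.
rewrite -[X in dot w X](subrK (e j)) (dotDr Hdot) addrC.
have h1 : `|dot w (w - e j)| <= `|w| * (eps / (`|w| + q)).
  by rewrite (le_trans (dot_cauchy_schwarz Hdot _ _))// ler_wpM2l// ltW.
have h2 : `|e j| <= `|w| + eps / (`|w| + q).
  rewrite -[e j](subrK w) addrC (le_trans (ler_normD _ _))// lerD2l distrC.
  exact: ltW.
have h3 := le_trans (ler_norm _) h1.
have h4 := ler_wpM2l q0 h2.
have h5 := wq j.
have -> : eps = `|w| * (eps / (`|w| + q)) + q * (eps / (`|w| + q)).
  by rewrite -mulrDl mulrCA divff ?mulr1// gt_eqF// ltr_wpDr.
by move: h3 h4 h5; rewrite mulrDr; lra.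
Qed.

(** Weak measurability implies Borel measurability, as in Pettis' theorem: an open set is the union
    of the closed balls it contains with centre [e j] and radius 1/(k+1), and each such ball is cut
    out by countably many scalar conditions. *)
Lemma measurable_fun_dot {d} {T : measurableType d} (D : set T)
    (Z : T -> borel H) :
  (forall v, measurable_fun D (fun t => dot (Z t) v)) -> measurable_fun D Z.
Proof.
move=> mZ; have [e eD] := separable_dense_seq Hsep.
move=> mD; suff h : preimage_set_system D Z (@open H) `<=` measurable.
  exact: (@measurability _ _ _ (borel H) D Z (@open H) erefl h mD).
move=> _ [U oU <-].
pose q (k : nat) : R := k.+1%:R^-1.
pose B j k := \bigcap_i (D `&` (fun t => dot (Z t) (e i)) @^-1`
  `]-oo, q k * `|e i| + dot (e j) (e i)]).
have q0 k : 0 <= q k by rewrite invr_ge0.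
have BE j k t : B j k t <-> D t /\ `|Z t - e j| <= q k.
  rewrite (norm_le_dense eD)//; split=> [Bt|[Dt h] i _].
    split=> [|i]; first by have [] := Bt 0%N I.
    by have [_ /=] := Bt i I; rewrite in_itv/= (dotBl Hdot) lerBlDr.
  by split => //=; rewrite in_itv/= -lerBlDr -(dotBl Hdot).
have mB j k : measurable (B j k).
  by apply: bigcapT_measurable => i; exact: mZ.
rewrite (_ : _ `&` _ = \bigcup_(j in [set: nat]) \bigcup_(k in
    [set k | forall z, `|z - e j| <= q k -> U z]) B j k).
  by apply: bigcup_measurable => j _; apply: bigcup_measurable => k _.
apply/seteqP; split=> t /=; last first.
  by move=> [j _ [k kU /BE[Dt Zt]]]; split => //; exact: kU.
move=> [Dt UZ].
have /nbhs_ballP[r /= r0 rU] : nbhs (Z t : H) U by exact: open_nbhs_nbhs.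
have [k kr] : exists k, q k < r / 2.
  near \oo => k; exists k.
  near: k; apply: (near_infty_natSinv_lt (PosNum (divr_gt0 r0 (ltr0n _ 2)))).
have qk : 0 < q k by rewrite invr_gt0.
have [j Zj] := eD (Z t) _ qk.
exists j => //; exists k => /=; last by apply/BE; split => //; exact: ltW.
move=> z zj; apply: rU; rewrite -ball_normE/= -(subrK (e j) (Z t)) -addrA.
rewrite (le_lt_trans (ler_normD _ _))// (splitr r) (distrC (e j)).
by rewrite ltrD// ?(lt_trans Zj)// (le_lt_trans zj).
Unshelve. all: by end_near. Qed.

Lemma measurable_funHD {d} {T : measurableType d} (D : set T)
    (Z Z' : T -> borel H) :
  measurable_fun D Z -> measurable_fun D Z' ->
  measurable_fun D (fun t => (Z t : H) + Z' t : borel H).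
Proof.
move=> mZ mZ'; apply: measurable_fun_dot => v.
under eq_fun do rewrite (dotDl Hdot).
by apply: measurable_funD; apply: (measurableT_comp (measurable_dot v)).
Qed.

Lemma measurable_funHZ {d} {T : measurableType d} (D : set T) (c : R)
    (Z : T -> borel H) :
  measurable_fun D Z ->
  measurable_fun D (fun t => c *: (Z t : H) : borel H).
Proof.
move=> mZ; apply: measurable_fun_dot => v.
under eq_fun do rewrite (dotZl Hdot).
by apply: measurable_funM => //; apply: (measurableT_comp (measurable_dot v)).
Qed.

End hilbert_borel.

(** * Laws determined by their one-dimensional marginals *)

Section threshold.
Context {R : realType}.
Implicit Types x : R.

Lemma bernoulli_le x n : -1 <= x -> 1 + n%:R * x <= (1 + x) ^+ n.
Proof.
move=> x1; elim: n => [|n IH]; first by rewrite mul0r addr0 expr0.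
have x10 : 0 <= 1 + x by lra.
rewrite exprS; apply: le_trans (ler_wpM2l x10 IH).
rewrite -natr1; have : 0 <= n%:R * (x * x) by rewrite mulr_ge0// -expr2 sqr_ge0.
by lra.
Qed.

Lemma cvg_natr_expr x : 0 <= x < 1 -> (n%:R * x ^+ n) @[n --> \oo] --> (0 : R).
Proof.
move=> /andP[]; rewrite le_eqVlt => /predU1P[<- _|x0 x1].
  apply: (@cvg_trans _ (cst (0 : R) @ \oo)); last exact: cvg_cst.
  apply: near_eq_cvg; near=> n; rewrite /= expr0n gtn_eqF ?mulr0//.
  by near: n; exists 1%N.
(* A ratio [s] strictly between [x] and 1: Bernoulli gives n c <= (s/x)^n, so n x^n <= s^n / c, a
   null geometric sequence. *)
pose s := (1 + x) / 2; pose c := s / x - 1.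
have sx : x < s by rewrite /s; lra.
have c0 : 0 < c by rewrite /c subr_gt0 ltr_pdivlMr// mul1r.
have s0 : 0 < s by rewrite /s; lra.
have s1 : `|s| < 1 by rewrite ger0_norm ?(ltW s0)// /s; lra.
apply: (@squeeze_cvgr _ _ _ _ (cst 0) (geometric c^-1 s)).
- apply: nearW => n /=; rewrite mulr_ge0 ?exprn_ge0 ?(ltW x0)//=.
  rewrite [leRHS]mulrC ler_pdivlMr// mulrAC -ler_pdivlMr ?exprn_gt0//.
  have E : s / x = 1 + c by rewrite /c addrC subrK.
  rewrite -expr_div_n E.
  by apply: (le_trans _ (@bernoulli_le c n _)); [rewrite lerDr|lra].
- exact: cvg_cst.
- exact: cvg_geometric.
Unshelve. all: by end_near. Qed.

(* Polynomials converging on [0, 1] to the indicator of [0, 1/2[: they turn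
   trigonometric polynomials into indicators of [wave] sets. *)
Definition threshold n x := (1 - x ^+ n) ^+ (n * 2 ^ n).

Lemma threshold_ge0_le1 n x : 0 <= x <= 1 -> 0 <= threshold n x <= 1.
Proof.
move=> /andP[x0 x1]; have : 0 <= 1 - x ^+ n <= 1.
  by rewrite subr_ge0 exprn_ile1//= lerBlDr lerDl exprn_ge0.
by move=> /andP[h0 h1]; rewrite exprn_ge0//= exprn_ile1.
Qed.

(** Bernoulli bounds the value below by 1 - n (2x)^n, and 2x < 1. *)
Lemma cvg_threshold_lt x : 0 <= x < 2^-1 -> threshold n x @[n --> \oo] --> (1 : R).
Proof.
move=> /andP[x0 x1].
apply: (@squeeze_cvgr _ _ _ _ (fun n => 1 - n%:R * (2 * x) ^+ n) (cst 1)).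
- apply: nearW => n /=; have /andP[_ ->] : 0 <= threshold n x <= 1.
    by rewrite threshold_ge0_le1// x0/=; lra.
  rewrite andbT; apply: le_trans (bernoulli_le _ _).
    by rewrite natrM exprMn natrX mulrN mulrA.
  by rewrite lerN2 exprn_ile1//; lra.
- rewrite -[X in _ --> X]subr0; apply: cvgB; first exact: cvg_cst.
  by apply: cvg_natr_expr; rewrite mulr_ge0//=; lra.
- exact: cvg_cst.
Qed.

(** From 1 - u <= exp(-u) and x^n >= 2^-n, the power n 2^n yields the upper bound exp(-n). *)
Lemma cvg_threshold_ge x : 2^-1 <= x <= 1 -> threshold n x @[n --> \oo] --> (0 : R).
Proof.
move=> /andP[x0 x1]; have x0' : 0 <= x by lra.
apply: (@squeeze_cvgr _ _ _ _ (cst 0) (fun n => expR (1 *- n))).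
- apply: nearW => n /=; have /andP[-> _] : 0 <= threshold n x <= 1.
    by rewrite threshold_ge0_le1// x0'.
  rewrite /= (@le_trans _ _ (expR (- 2^-1 ^+ n) ^+ (n * 2 ^ n)))//.
    rewrite lerXn2r// ?nnegrE ?subr_ge0 ?exprn_ile1 ?expR_ge0//.
    by rewrite (le_trans _ (expR_ge1Dx _))// lerD2l lerN2 lerXn2r// nnegrE//; lra.
  rewrite -expRM_natr ler_expR natrM natrX mulNr mulrCA exprVn mulVf ?mulr1//.
- exact: cvg_cst.
- exact: cvgn_expR.
Qed.

End threshold.

(** * Trigonometric polynomials and the Borel sets generated by waves *)

Section ridge_sets.
Context {R : realType} {H : completeNormedModType R} {dot : H -> H -> R}.
Hypotheses (Hdot : inner_product dot) (Hsep : @separable R H).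

(** The phase [t] accounts for sines, and zero frequency gives constants. By the product-to-sum
    formula these functions form an algebra, so polynomials may be applied to them. *)
Inductive trig : (H -> R) -> Prop :=
| trig_cos v t : trig (fun z => cos (dot z v + t))
| trigD f g : trig f -> trig g -> trig (fun z => f z + g z)
| trigZ c f : trig f -> trig (fun z => c * f z).

Lemma trig_cst c : trig (fun=> c).
Proof.
rewrite (_ : (fun=> c) = fun z => c * cos (dot z 0 + 0)); first exact/trigZ/trig_cos.
by apply/funext => z; rewrite addr0 (dot_sym Hdot) (dot0l Hdot) cos0 mulr1.
Qed.

Lemma trigM f g : trig f -> trig g -> trig (fun z => f z * g z).
Proof.
move=> tf tg; elim: tf => [v t|f1 f2 _ t1 _ t2|c f1 _ t1].
- elim: tg => [w s|g1 g2 _ t1 _ t2|c g1 _ t1].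
  + rewrite (_ : (fun _ => _) = fun z => 2^-1 * (cos (dot z (v + w) + (t + s)) +
        cos (dot z (v - w) + (t - s)))).
      by apply/trigZ/trigD; exact: trig_cos.
    apply/funext => z; rewrite (dotDr Hdot) (dotBr Hdot) addrACA.
    have -> : dot z v - dot z w + (t - s) = dot z v + t - (dot z w + s) by lra.
    by rewrite (cosD (dot z v + t) (dot z w + s)) (cosB (dot z v + t) (dot z w + s)); lra.
  + under eq_fun do rewrite mulrDr.
    exact: trigD.
  + under eq_fun do rewrite mulrCA.
    exact: trigZ.
- under eq_fun do rewrite mulrDl.
  exact: trigD.
- under eq_fun do rewrite -mulrA.
  exact: trigZ.
Qed.

Lemma trigX f n : trig f -> trig (fun z => f z ^+ n).
Proof.
move=> tf; elim: n => [|n IH]; first exact: trig_cst.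
by under eq_fun do rewrite exprS; exact: trigM.
Qed.

Lemma measurable_trig f : trig f -> measurable_fun [set: borel H] f.
Proof.
elim=> [v t|f1 f2 _ m1 _ m2|c f1 _ m1].
- apply: (measurableT_comp (continuous_measurable_fun (@continuous_cos R))).
  by apply: measurable_funD => //; exact: measurable_dot.
- exact: measurable_funD.
- by apply: measurable_funM.
Qed.

Lemma trig_bounded f : trig f -> exists M, forall z, `|f z| <= M.
Proof.
elim=> [v t|f1 f2 _ [M1 b1] _ [M2 b2]|c f1 _ [M b]].
- by exists 1 => z; rewrite ler_norml cos_geN1 cos_le1.
- by exists (M1 + M2) => z; rewrite (le_trans (ler_normD _ _))// lerD.
- by exists (`|c| * M) => z; rewrite normrM ler_wpM2l.
Qed.

Lemma integrable_trig (P : probability (borel H) R) f :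
  trig f -> P.-integrable setT (EFin \o f).
Proof.
move=> tf; have [M fM] := trig_bounded tf.
apply: (@le_integrable _ _ _ _ _ _ _ (EFin \o cst M)) => //.
- by apply/measurable_EFinP; exact: measurable_trig.
- by move=> z _; rewrite /= lee_fin (le_trans (fM z))// ler_norm.
- exact: finite_measure_integrable_cst.
Qed.

Lemma trig_threshold v t n :
  trig (fun z => threshold n ((1 + cos (dot z v + t)) / 2)).
Proof.
apply: trigX.
under eq_fun do rewrite -mulN1r.
apply: trigD; first exact: trig_cst.
apply: trigZ; apply: trigX.
under eq_fun do rewrite mulrC.
by apply/trigZ/trigD; [exact: trig_cst|exact: trig_cos].
Qed.

(* Half-spaces cut out by a wave; for frequencies tending to 0 they exhaust the
   half-spaces cut out by a linear functional. *)
Definition wave (p : H * R) : set H := [set z | cos (dot z p.1 + p.2) < 0].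

(** Finite intersections are taken so that the family is a pi-system, ready for Dynkin's lemma. *)
Definition wave_sets : set (set H) :=
  [set B | exists s : seq (H * R), B = \bigcap_(p in [set` s]) wave p].

Lemma wave_sets_setI : setI_closed wave_sets.
Proof.
move=> _ _ [s ->] [s' ->]; exists (s ++ s').
by rewrite -bigcap_setU; congr (bigcap _ _); apply/seteqP; split=> p /=;
  rewrite mem_cat => /orP.
Qed.

Lemma measurable_wave p : measurable (wave p : set (borel H)).
Proof.
rewrite (_ : wave p = (fun z => cos (dot z p.1 + p.2)) @^-1` `]-oo, 0[).
  by rewrite -[X in measurable X]setTI; exact: (measurable_trig (trig_cos _ _)).
by apply/seteqP; split=> z; rewrite /wave/= in_itv.
Qed.

Lemma measurable_wave_sets (B : set (borel H)) : wave_sets B -> measurable B.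
Proof.
by move=> [s ->]; rewrite bigcap_seq; apply: bigsetI_measurable => p _;
  exact: measurable_wave.
Qed.

(** It suffices to obtain the half-spaces [c < dot z v]. The phase of [p k] turns the cosine into
    minus the sine of ([dot z v] - c)/(k+1); for large [k] this argument lies in ]-pi, pi[, where
    the sine has the sign of its argument. Each half-space is thus a lower limit of waves. *)
Lemma borel_wave_sets : @measurable _ (borel H) = <<s wave_sets >>.
Proof.
apply/seteqP; split=> B; last first.
  by apply: smallest_sub; [exact: sigma_algebra_measurable|
    exact: measurable_wave_sets].
(* Measurability of the identity between the two sigma-algebras is the missing inclusion, and it may
   be checked weakly. *)
pose id' (z : g_sigma_algebraType wave_sets) : borel H := z.
suff : measurable_fun setT id'.
  by move=> /(_ measurableT B) + mB => /(_ mB); rewrite setTI.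
apply: (measurable_fun_dot Hdot Hsep) => v.
move=> mT; suff h : preimage_set_system setT (fun t => dot (id' t) v)
    (@RGenOInfty.G R) `<=` measurable.
  exact: (measurability _ (RGenOInfty.measurableE R) h mT).
move=> _ [_ [c ->] <-]; rewrite setTI.
pose p (k : nat) : H * R := (k.+1%:R^-1 *: v, pi / 2 - c / k.+1%:R).
rewrite (_ : _ @^-1` _ = \bigcup_n \bigcap_(k in [set k | (n <= k)%N]) wave (p k)).
  apply: bigcup_measurable => n _; apply: bigcap_measurable; first by exists n => /=.
  move=> k _; apply: sub_sigma_algebra; exists [:: p k].
  by rewrite bigcap_seq big_seq1.
have wE k z : wave (p k) z <-> 0 < sin ((dot z v - c) / k.+1%:R).
  rewrite /wave /p /= (dotZr Hdot).
  have -> : k.+1%:R^-1 * dot z v + (pi / 2 - c / k.+1%:R) =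
    (dot z v - c) / k.+1%:R + pi / 2 by move: (k.+1%:R^-1) => i; lra.
  by rewrite (cosD _ (pi / 2)) cos_pihalf sin_pihalf mulr0 mulr1 sub0r oppr_lt0.
have large z : exists n, forall k, (n <= k)%N ->
    `|dot z v - c| / k.+1%:R < pi.
  exists (Num.truncn (`|dot z v - c| / pi)) => k nk.
  rewrite ltr_pdivrMr// mulrC -ltr_pdivrMr ?pi_gt0//.
  by rewrite (lt_le_trans (Num.Theory.truncnS_gt _))// ler_nat.
apply/seteqP; split=> z; rewrite /= in_itv/= andbT.
- move=> cz; have [n nP] := large z; exists n => // k /= /nP.
  rewrite wE gtr0_norm ?subr_gt0// => kpi.
  by rewrite sin_gt0_pi// kpi divr_gt0// subr_gt0.
- move=> [n _ nP]; have [m mP] := large z; rewrite ltNge; apply/negP => zc.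
  have := nP (maxn n m); rewrite /= leq_maxl => /(_ isT)/wE; apply/negP; rewrite -leNgt.
  have := mP (maxn n m); rewrite leq_maxr => /(_ isT).
  rewrite ler0_norm ?subr_le0// => h.
  rewrite -(opprK (_ / _)) sinN oppr_le0 sin_ge0_pi//.
  by rewrite -mulNr (ltW h) andbT divr_ge0// oppr_ge0 subr_le0.
Qed.

End ridge_sets.

(** * Families of laws whose marginals depend measurably on a parameter *)

Section marginals.
Context {R : realType} {H : completeNormedModType R} {dot : H -> H -> R}.
Hypotheses (Hdot : inner_product dot) (Hsep : @separable R H).
Context {d : measure_display} {X : measurableType d}.
Variable kappa : X -> probability (borel H) R.
Hypothesis mkappa : forall v (B : set R), measurable B ->
  measurable_fun [set: X] (fun p => kappa p [set z | B (dot z v)]).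

Lemma measurable_integral_trig f : trig (dot := dot) f ->
  measurable_fun [set: X] (fun p => \int[kappa p]_z (f z)%:E)%E.
Proof.
elim=> [v t|f1 f2 t1 m1 t2 m2|c f1 t1 m1].
- pose F (z : borel H) : R := dot z v.
  have mF : measurable_fun setT F := measurable_dot Hdot v.
  (* The shift by 1 makes the integrand non-negative, as the theorem on kernel integrals demands;
     the total mass 1 is subtracted afterwards. *)
  pose k (r : R) : \bar R := (cos (r + t) + 1)%:E.
  have mk : measurable_fun setT k.
    apply/measurable_EFinP/measurable_funD => //.
    apply: (measurableT_comp (continuous_measurable_fun (@continuous_cos R))).
    exact: measurable_funD.
  have k0 r : (0 <= k r)%E.
    by rewrite lee_fin; have := cos_geN1 (r + t); lra.
  have h := @measurable_fun_integral_kernel _ _ X R R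
    (fun p => pushforward (kappa p) F) (fun B mB => mkappa v mB) k k0 mk.
  have {}h := h mF.
  apply: (eq_measurable_fun (fun p => \int[pushforward (kappa p) F]_r k r - 1)%E).
    move=> p _; rewrite (ge0_integral_pushforward mF)//=.
    rewrite preimage_setT /comp /k /=.
    under eq_integral do rewrite EFinD.
    rewrite integralD//; last 2 first.
      exact: (integrable_trig Hdot _ (@trig_cos _ _ dot v t)).
      exact: finite_measure_integrable_cst.
    rewrite integral_cst//= probability_setT mule1.
    by rewrite addeK.
  by apply: emeasurable_funB; [exact: h|exact: measurable_cst].
- apply: (eq_measurable_fun (fun p => \int[kappa p]_z (f1 z)%:E +
      \int[kappa p]_z (f2 z)%:E)%E).
    move=> p _; under [RHS]eq_integral do rewrite EFinD.
    by rewrite integralD//; exact: (integrable_trig Hdot (kappa p)).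
  exact: emeasurable_funD.
- apply: (eq_measurable_fun (fun p => c%:E * \int[kappa p]_z (f1 z)%:E)%E).
    move=> p _; under [RHS]eq_integral do rewrite EFinM.
    by rewrite integralZl//; exact: (integrable_trig Hdot (kappa p)).
  exact: measurable_funeM.
Qed.

Lemma measurable_kernel_wave_sets (B : set (borel H)) :
  wave_sets (dot := dot) B -> measurable_fun [set: X] (fun p => kappa p B).
Proof.
move=> BS; have mB := measurable_wave_sets Hdot BS.
move: BS => [s Bs].
(* The affine map sends negative cosines to [0, 1/2[ and the others to [1/2, 1], so each factor is a
   trigonometric polynomial tending boundedly to the indicator of its wave. *)
pose f n z := \prod_(p <- s) threshold n ((1 + cos (dot z p.1 + p.2)) / 2).
have range v t z : 0 <= (1 + cos (dot z v + t)) / 2 <= 1.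
  by have := cos_geN1 (dot z v + t); have := cos_le1 (dot z v + t); lra.
have tf n : trig (dot := dot) (f n).
  rewrite /f; elim: (s) => [|p s' IH].
    by under eq_fun do rewrite big_nil; exact: (trig_cst Hdot).
  under eq_fun do rewrite big_cons.
  by apply: (trigM Hdot) => //; exact: (trig_threshold Hdot).
have f01 n z : 0 <= f n z <= 1.
  rewrite /f; elim: (s) => [|p s' /andP[IH0 IH1]].
    by rewrite big_nil ler01 lexx.
  rewrite big_cons; have /andP[h0 h1] := threshold_ge0_le1 n (range p.1 p.2 z).
  by rewrite mulr_ge0//= mulr_ile1.
have fB z : f n z @[n --> \oo] --> (\1_B z : R).
  rewrite /f Bs bigcap_seq; elim: (s) => [|p s' IH].
    by rewrite big_nil indicT; under eq_fun do rewrite big_nil; exact: cvg_cst.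
  rewrite big_cons indicI; under eq_fun do rewrite big_cons.
  apply: cvgM => //; rewrite indicE.
  have [zp|zp] := pselect (wave (dot := dot) p z).
    rewrite mem_set//; apply: cvg_threshold_lt.
    have := range p.1 p.2 z; move: zp; rewrite /wave/=.
    by move: (cos _) => c; lra.
  rewrite memNset//; apply: cvg_threshold_ge.
  have := range p.1 p.2 z; move: zp; rewrite /wave/= => /negP; rewrite -leNgt.
  by move: (cos _) => c; lra.
apply: (emeasurable_fun_cvg (fun n p => \int[kappa p]_z (f n z)%:E)%E).
  by move=> n; exact: measurable_integral_trig.
move=> p _; rewrite -(setIT B) -(integral_indic _ measurableT)//.
have [||||//|_ _] := @dominated_convergence _ _ _ (kappa p) setT measurableT
  (fun n z => (f n z)%:E) (fun z => (\1_B z)%:E) (cst 1%E).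
- by move=> n; apply/measurable_EFinP; exact: (measurable_trig Hdot (tf n)).
- exact/measurable_EFinP/measurable_indic.
- by apply: aeW => z _; apply: cvg_EFin; [exact: nearW|exact: fB].
- exact: (finite_measure_integrable_cst _ 1).
- apply: aeW => z n _ /=; rewrite lee_fin.
  by have /andP[? ?] := f01 n z; rewrite ger0_norm.
by [].
Qed.

(** The sets with a measurable value form a Dynkin class, complements being handled by the total
    mass one, and this class contains the pi-system of wave sets. *)
Lemma measurable_kernel_marginals (B : set (borel H)) :
  measurable B -> measurable_fun [set: X] (fun p => kappa p B).
Proof.
move=> mB; have E := borel_wave_sets Hdot Hsep.
have : <<s wave_sets (dot := dot) >> B by rewrite -E.
apply: (dynkin_induction (P := fun B => measurable_fun setT (fun p => kappa p B)) E).
- exact: wave_sets_setI.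
- by under eq_fun do rewrite probability_setT; exact: measurable_cst.
- exact: measurable_kernel_wave_sets.
- move=> S mS mk; under eq_fun do rewrite probability_setC//.
  by apply: emeasurable_funB; [exact: measurable_cst|exact: mk].
- move=> F mF tF mk.
  under eq_fun do rewrite measure_bigcup//.
  by apply: ge0_emeasurable_sum => [k p _ _|k _]; [exact: measure_ge0|exact: mk].
Qed.

End marginals.

(** * Measurable dependence on time *)

Section grid.
Context {R : realType}.

(** Rounding down keeps the grid point in [0, s] for [0 <= s], so that [s - grid k s] is an
    admissible semigroup time. *)
Definition grid (k : nat) (s : R) : R := (Num.truncn (s * k.+1%:R))%:R / k.+1%:R.

Lemma grid_ge0 k s : 0 <= grid k s.
Proof. by rewrite divr_ge0. Qed.

Lemma grid_le k s : 0 <= s -> grid k s <= s.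
Proof. by move=> s0; rewrite ler_pdivrMr// truncn_le// mulr_ge0. Qed.

Lemma cvg_grid s : 0 <= s -> grid k s @[k --> \oo] --> s.
Proof.
move=> s0; apply: (@squeeze_cvgr _ _ _ _ (fun k => s - k.+1%:R^-1) (cst s)).
- apply: nearW => k; rewrite grid_le// andbT lerBlDr /grid -[X in _ + X]mul1r -mulrDl.
  by rewrite ler_pdivlMr// natr1 ltW// truncnS_gt.
- rewrite -[X in _ --> X]subr0; apply: cvgB; first exact: cvg_cst.
  exact: cvg_harmonic.
- exact: cvg_cst.
Qed.

(* Caratheodory functions: the time argument is discretised from the left, so
   that only left-continuity in time is needed. *)
Lemma measurable_fun_caratheodory {d} {X : measurableType d} (T : R)
    (psi : R -> X -> R) :
  (forall s, 0 <= s <= T -> measurable_fun [set: X] (psi s)) ->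
  (forall s x, 0 <= s <= T -> psi (grid k s) x @[k --> \oo] --> psi s x) ->
  measurable_fun [set p : R * X | 0 <= p.1 <= T] (fun p => psi p.1 p.2).
Proof.
move=> mpsi cpsi; set D := [set p : R * X | _].
have mD : measurable D.
  rewrite (_ : D = fst @^-1` `[0, T]%classic).
    by rewrite -[X in measurable X]setTI; exact: measurable_fst.
  by apply/seteqP; split=> p; rewrite /D/= in_itv.
apply: (@measurable_fun_cvg _ _ _ _ (fun k p => psi (grid k p.1) p.2)); last first.
  by move=> [s x] Dsx; exact: cpsi.
move=> k; pose N (p : R * X) := Num.truncn (p.1 * k.+1%:R).
have NE j : D `&` N @^-1` [set j] =
    D `&` fst @^-1` `[j%:R / k.+1%:R, j.+1%:R / k.+1%:R[%classic.
  apply/seteqP; split=> [[s x] [Ds /= <-]|[s x] [Ds /=]]; split => //=.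
    rewrite ?in_itv/= ler_pdivrMr// ltr_pdivlMr// truncn_itv//.
    by move: Ds => /andP[s0 _]; rewrite mulr_ge0.
  by apply: truncn_def; rewrite -ler_pdivrMr// -ltr_pdivlMr//.
have mN j : measurable (D `&` N @^-1` [set j]).
  rewrite NE; apply: measurableI => //.
  by rewrite -[X in measurable X]setTI; exact: measurable_fst.
apply: (measurable_fun_glue (N := N) (f := fun j p => psi (j%:R / k.+1%:R) p.2)) => // j.
(* A grid point beyond [T] is never the rounding of a time in [0, T], so its piece is empty. *)
have [jT|jT] := leP (j%:R / k.+1%:R) T.
  apply: measurable_funTS; apply: measurableT_comp => //.
  by apply: mpsi; rewrite divr_ge0.
rewrite (_ : _ `&` _ = set0); first exact: measurable_fun_set0.
apply/seteqP; split=> //= -[s x] [/andP[s0 sT] /= Nj].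
have := grid_le k s0; rewrite /grid -/(N (s, x)) Nj => /le_lt_trans.
by move=> /(_ _ (le_lt_trans sT jT)); rewrite ltxx.
Qed.

Lemma measurable_integral_param {d} {X : measurableType d}
    (f : X * R -> \bar R) : measurable_fun setT f ->
  measurable_fun setT (fun x => \int[lebesgue_measure]_s f (x, s))%E.
Proof.
move=> mf; under eq_fun do rewrite integralE.
apply: emeasurable_funB.
- have := @measurable_fun_fubini_tonelli_F _ _ X _ R lebesgue_measure _
    (measurable_funepos mf) (fun p => funepos_ge0 f p).
  apply: eq_measurable_fun => x _; rewrite /fubini_F.
  by apply: eq_integral => s _; rewrite !(funeposE,funenegE).
- have := @measurable_fun_fubini_tonelli_F _ _ X _ R lebesgue_measure _
    (measurable_funeneg mf) (fun p => funeneg_ge0 f p).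
  apply: eq_measurable_fun => x _; rewrite /fubini_F.
  by apply: eq_integral => s _; rewrite !(funeposE,funenegE).
Qed.

(** The domain of integration may move with the parameter, as a section of [A]; this covers
    intervals with variable endpoints. *)
Lemma measurable_Rintegral_param {d} {X : measurableType d}
    (A : set (X * R)) (f : X * R -> R) : measurable A -> measurable_fun A f ->
  measurable_fun setT (fun x => \int[lebesgue_measure]_(s in xsection A x) f (x, s)).
Proof.
move=> mA mf.
have mF : measurable_fun setT ((EFin \o f) \_ A).
  by apply/(measurable_restrictT _ mA)/measurable_EFinP.
have := measurable_integral_param mF.
move=> /(measurableT_comp (fine_measurable measurableT)).
apply: eq_measurable_fun => x _ /=; congr fine.
rewrite [RHS]integral_mkcond; apply: eq_integral => s _.
by rewrite /patch/= mem_xsection.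
Qed.

Lemma measurable_invr : measurable_fun [set: R] (fun x : R => x^-1).
Proof.
pose g (x : R) : R := if 0 <= x then x `^ (-1) else - (- x) `^ (-1).
apply: (@eq_measurable_fun _ _ R R setT g); rewrite /g.
  move=> x _; case: leP => x0; first by rewrite powR_inv1.
  by rewrite powR_inv1 ?oppr_ge0 ?ltW// invrN opprK.
apply: measurable_fun_ifT; first exact: measurable_fun_ler.
  exact: measurable_powR.
apply: measurableT_comp => //.
by apply: (measurableT_comp (measurable_powR (-1))).
Qed.

Lemma measurable_normal_law {d} {X : measurableType d} (b s : X -> R) (B : set R) :
  measurable_fun setT b -> measurable_fun setT s -> measurable B ->
  measurable_fun setT (fun p => normal_law (b p) (s p) B).
Proof.
move=> mb ms mB; rewrite /normal_law.
apply: measurable_fun_ifT; first exact: measurable_fun_eqr.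
  exact: (measurableT_comp (f := fun x => \d_x B) (measurable_fun_dirac mB) mb).
rewrite /normal_prob.
pose f (p : X * R) : \bar R := (normal_pdf (b p.1) (Num.sqrt (s p.1)) p.2)%:E.
have msq : measurable_fun setT (fun p : X * R => Num.sqrt (s p.1)).
  apply: (measurableT_comp (continuous_measurable_fun (@sqrt_continuous R))).
  exact: (measurableT_comp ms measurable_fst).
have mf : measurable_fun setT f.
  apply/measurable_EFinP; rewrite /normal_pdf; apply: measurable_fun_ifT.
  - exact: measurable_fun_eqr.
  (* For standard deviation 0, which the square root returns whenever [s p <= 0], [normal_pdf]
     defaults to this indicator. *)
  - have m01 : measurable_fun [set: R] (\1_`[0, 1] : R -> R).
      by apply: measurable_indic; exact: measurable_itv.
    exact: (measurableT_comp m01 measurable_snd).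
  apply: measurable_funM.
    rewrite /normal_peak; apply: (measurableT_comp measurable_invr).
    apply: (measurableT_comp (continuous_measurable_fun (@sqrt_continuous R))).
    under eq_fun do rewrite mulr2n.
    by apply: measurable_funD; apply: measurable_funM => //;
      exact: measurable_funX.
  rewrite /normal_fun; apply: measurableT_comp => //; apply: measurable_funM.
    apply: measurableT_comp => //; apply: measurable_funX.
    apply: measurable_funB; first exact: measurable_snd.
    exact: (measurableT_comp mb measurable_fst).
  apply: (measurableT_comp measurable_invr).
  under eq_fun do rewrite mulr2n.
  by apply: measurable_funD; exact: measurable_funX.
have mC : measurable (snd @^-1` B : set (X * R)).
  by rewrite -[X in measurable X]setTI; exact: measurable_snd.
have := measurable_integral_param ((measurable_restrictT f mC).1 (measurable_funTS mf)).
apply: eq_measurable_fun => p _.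
rewrite [RHS]integral_mkcond; apply: eq_integral => x _.
rewrite /patch (_ : ((p, x) \in snd @^-1` B) = (x \in B))//.
Qed.

End grid.

Lemma cvg_semigroup {R : realType} {H : completeNormedModType R}
    (S : R -> {linear H -> H}) (HS : C0_semigroup S) (x : H) (h : R^nat) :
  (forall k, 0 <= h k) -> h k @[k --> \oo] --> (0 : R) ->
  S (h k) x @[k --> \oo] --> x.
Proof.
move=> h0 hcvg; apply/cvgrPdist_lt => e e0.
have /cvgrPdist_lt /(_ _ e0) := @semigroup_cvg _ _ _ HS x.
rewrite /at_right near_withinE => -[r /= r0 rS].
move/cvgrPdist_lt: hcvg => /(_ _ r0); apply: filterS => k hk.
(* The right-hand limit at 0 says nothing about lag 0 itself, where the semigroup is the
   identity. *)
have := h0 k; rewrite le_eqVlt => /predU1P[<-|hk0].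
  by rewrite (semigroup0 HS) subrr normr0.
exact: rS.
Qed.

(** * Ornstein-Uhlenbeck kernels as functions of the starting point and starting time *)

Section ornstein_uhlenbeck.
Context {R : realType} {H : completeNormedModType R} {dot : H -> H -> R}.
Hypotheses (Hdot : inner_product dot) (Hsep : @separable R H).
Context {S : R -> {linear H -> H}} (HS : C0_semigroup S).
Context {Q : H -> H} {a : R -> H} {nu : R -> R -> H -> probability (borel H) R}.
Hypothesis Hnu : OU_kernel dot S Q a nu.

(** [OU_kernel] provides the mean and covariance separately for each pair of times. Tested against
    [v], they are integrals of fixed functions over [s, t] and [0, t - s]; as sections of the planar
    sets [D1] and [D2] these intervals give measurable dependence on [s]. *)
Lemma OU_marginal t v : 0 <= t -> exists M V : R -> R,
  [/\ measurable_fun setT M, measurable_fun setT V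
    & forall s x B, 0 <= s <= t -> measurable B ->
      nu s t x [set z | B (dot z v)] =
      normal_law (dot (S (t - s) x) v + M s) (V s) B].
Proof.
move=> t0.
pose phi u := dot (S (t - u) (a u)) v.
pose psi u := dot (S u (Q (adjoint dot (S u) v))) v.
(* The case s = 0 supplies measurability of both integrands on all of [0, t]. *)
have [m0 [C0 [[mphi _ _] bC0 _]]] : exists m : H, exists C : H -> H,
    [/\ bochner_integral dot 0 t (fun u => S (t - u) (a u)) m,
        forall v, bochner_integral dot 0 (t - 0)
          (fun u => S u (Q (adjoint dot (S u) v))) (C v)
      & forall x, gaussian_measure dot (nu 0 t x) (S (t - 0) x + m) C].
  by apply: Hnu; rewrite lexx.
have [mpsi _ _] := bC0 v; rewrite subr0 in mpsi.
pose D1 := [set p : R * R | p.1 <= p.2 /\ p.2 \in `[0, t]].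
pose D2 := [set p : R * R | p.1 + p.2 <= t /\ p.2 \in `[0, t]].
have m1 (f : R * R -> R) : measurable_fun setT f ->
    measurable [set p : R * R | f p <= 0 /\ p.2 \in `[0, t]].
  move=> mf; rewrite (_ : mkset _ = f @^-1` `]-oo, 0] `&` snd @^-1` `[0, t]).
    by apply: measurableI; rewrite -[X in measurable X]setTI;
      [exact: mf|exact: measurable_snd].
  by apply/seteqP; split=> p /=; rewrite in_itv.
have mD1 : measurable D1.
  rewrite (_ : D1 = [set p | (fun p => p.1 - p.2) p <= 0 /\ p.2 \in `[0, t]]).
    by apply: m1; apply: measurable_funB.
  by apply/seteqP; split=> p; rewrite /D1/= subr_le0.
have mD2 : measurable D2.
  rewrite (_ : D2 = [set p | (fun p => p.1 + p.2 - t) p <= 0 /\ p.2 \in `[0, t]]).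
    by apply: m1; apply: measurable_funB => //; apply: measurable_funD.
  by apply/seteqP; split=> p; rewrite /D2/= subr_le0.
have mf1 : measurable_fun D1 (fun p => phi p.2).
  apply: (@measurable_comp _ _ _ _ _ _ `[0, t]%classic phi _ snd) => //.
  - by move=> _ [p [_ /= p2] <-].
  - exact: (measurableT_comp (measurable_dot Hdot v) mphi).
  - exact: (measurable_funTS measurable_snd).
have mf2 : measurable_fun D2 (fun p => psi p.2).
  apply: (@measurable_comp _ _ _ _ _ _ `[0, t]%classic psi _ snd) => //.
  - by move=> _ [p [_ /= p2] <-].
  - exact: (measurableT_comp (measurable_dot Hdot v) mpsi).
  - exact: (measurable_funTS measurable_snd).
exists (fun s => \int[lebesgue_measure]_(u in xsection D1 s) phi u).
exists (fun s => \int[lebesgue_measure]_(u in xsection D2 s) psi u).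
split.
- exact: (measurable_Rintegral_param mD1 mf1).
- exact: (measurable_Rintegral_param mD2 mf2).
move=> s x B st mB.
have [m [C [[_ _ dotm] bC gauss]]] := Hnu st.
have [_ _ dotC] := bC v.
rewrite (gauss x v B mB) (dotDl Hdot) dotm dotC.
have /andP[s0 s_t] := st.
have -> : xsection D1 s = `[s, t]%classic.
  rewrite set_itvcc; apply/seteqP; split=> u /=;
    rewrite /xsection/= !inE /D1/= !in_itv/=.
  - by move=> [-> /andP[_ ->]].
  - by move=> /andP[su ut]; rewrite su ut (le_trans s0 su).
have -> : xsection D2 s = `[0, t - s]%classic.
  rewrite set_itvcc; apply/seteqP; split=> u /=;
    rewrite /xsection/= !inE /D2/= !in_itv/=.
  - by move=> [h /andP[u0 _]]; rewrite u0/=; lra.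
  - by move=> /andP[u0 ut]; rewrite u0; split=> /=; lra.
by [].
Qed.

Lemma measurable_OU_space s t (B : set (borel H)) : 0 <= s <= t -> measurable B ->
  measurable_fun [set: borel H] (fun x => nu s t x B).
Proof.
move=> st; have /andP[s0 s_t] := st.
apply: (@measurable_kernel_marginals _ _ _ Hdot Hsep _ (borel H) (nu s t)) => v B' mB'.
have [M [V [mM mV E]]] := OU_marginal v (le_trans s0 s_t).
under eq_fun do rewrite E//.
have mb : measurable_fun [set: borel H] (fun x => dot (S (t - s) x) v).
  apply: (continuous_borel_measurable (V := H)) => x.
  apply: (continuous_comp (f := S (t - s)) (g := dot^~ v)).
    by apply: (semigroup_bounded HS); rewrite subr_ge0.
  exact: (dot_continuous Hdot).
apply: measurable_normal_law => //.
exact: (measurable_funD mb (measurable_cst _)).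
Qed.

(** Projecting times onto [0, t] makes the kernels a family over the whole line, the kind of index
    that [measurable_kernel_marginals] takes. *)
Definition clamp (t s : R) : R := Num.max 0 (Num.min s t).

Lemma clamp_itv t s : 0 <= t -> 0 <= clamp t s <= t.
Proof. by move=> t0; rewrite /clamp le_max lexx/= ge_max t0/= ge_min lexx orbT. Qed.

Lemma measurable_OU_time t x (B : set (borel H)) : 0 <= t -> measurable B ->
  measurable_fun [set: R] (fun s => nu (clamp t s) t x B).
Proof.
move=> t0.
apply: (measurable_kernel_marginals Hdot Hsep (kappa := fun s => nu (clamp t s) t x)) => v B' mB'.
have [M [V [mM mV E]]] := OU_marginal v t0.
under eq_fun do rewrite E ?clamp_itv//.
have mc : measurable_fun [set: R] (clamp t).
  apply: measurable_maxr => //; exact: measurable_minr.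
apply: measurable_normal_law => //; last exact: measurableT_comp.
apply: measurable_funD; last exact: measurableT_comp.
(* The second variable is a dummy. Left continuity in [s] comes from S(t - r) = S(s - r) S(t - s)
   for grid points r <= s, with strong continuity at 0. *)
have := @measurable_fun_caratheodory R _ R t (fun s _ => dot (S (t - s) x) v).
move=> /(_ _ _)-h.
apply: (@measurable_comp _ _ _ _ _ _ [set p : R * R | 0 <= p.1 <= t]
  (fun p => dot (S (t - p.1) x) v) _ (fun s => (clamp t s, 0))).
- rewrite (_ : mkset _ = fst @^-1` `[0, t]%classic).
    by rewrite -[X in measurable X]setTI; exact: measurable_fst.
  by apply/seteqP; split=> p /=; rewrite in_itv.
- by move=> _ [s _ <-]/=; exact: clamp_itv.
- apply: h => // s _ /andP[s0 st].
  suff cS : S (t - grid k s) x @[k --> \oo] --> S (t - s) x.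
    exact: (cvg_comp _ _ cS (@dot_continuous _ _ _ Hdot v (S (t - s) x))).
  rewrite (_ : (fun k => _) = fun k => S (s - grid k s) (S (t - s) x)); last first.
    apply/funext => k; rewrite -(semigroupD HS) ?subr_ge0 ?grid_le//.
    by congr (S _ _); lra.
  apply: (cvg_semigroup HS) => [k|]; first by rewrite subr_ge0 grid_le.
  rewrite -[X in _ --> X](subrr s); apply: cvgB; first exact: cvg_cst.
  exact: cvg_grid.
- apply/measurable_fun_pairP; split; [exact: mc|exact: measurable_cst].
Qed.

End ornstein_uhlenbeck.

(** * Kernels at time lag zero *)

Section dirac_laws.
Context {R : realType} {H : completeNormedModType R} {dot : H -> H -> R}.
Hypotheses (Hdot : inner_product dot) (Hsep : @separable R H).

Lemma borel_open (U : set H) : open U -> measurable (U : set (borel H)).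
Proof. exact: sub_sigma_algebra. Qed.

Lemma borel_measurable_set1 (x : H) : measurable ([set x] : set (borel H)).
Proof.
rewrite -[X in measurable X]setCK; apply: measurableC; apply: borel_open.
by rewrite openC; apply: accessible_closed_set1; exact: hausdorff_accessible.
Qed.

Lemma dirac_law (P : {measure set (borel H) -> \bar R}) (x : H) (A : set (borel H)) :
  P setT = 1%E -> P (~` [set x]) = 0%E -> measurable A -> P A = \d_(x : borel H) A.
Proof.
move=> P1 Px mA; have mx := borel_measurable_set1 x; rewrite diracE.
have null (B : set (borel H)) : measurable B -> ~ B x -> P B = 0%E.
  move=> mB Bx; apply/eqP; rewrite eq_le measure_ge0 andbT -Px.
  apply: le_measure; rewrite ?inE//; first exact: measurableC.
  by move=> z Bz /= zx; apply: Bx; rewrite -zx.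
have [xA|xA] := pselect (A x); last by rewrite memNset// null.
have mCA := measurableC mA.
have PA : P setT = (P A + P (~` A))%E by rewrite -measureU ?setUv ?setICr.
have nA : P (~` A) = 0%E by apply: null => // /(_ xA).
by rewrite mem_set//= -P1 PA nA adde0.
Qed.

Lemma measure_bigcup_null {d} {T : measurableType d} (P : {measure set T -> \bar R})
    (F : nat -> set T) : (forall k, measurable (F k)) ->
  (forall k, P (F k) = 0%E) -> P (\bigcup_k F k) = 0%E.
Proof.
move=> mF F0; apply/eqP; rewrite eq_le measure_ge0 andbT.
have mUF := bigcup_measurable (fun k (_ : setT k) => mF k).
rewrite (le_trans (measure_sigma_subadditive _ mF mUF (subset_refl _)))//.
by rewrite eseries0.
Qed.

(** At zero lag both integrals vanish, so every marginal is a Dirac mass. A point other than [x] is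
    separated from it by some [e j], hence the complement of [x] is a countable union of null
    sets. *)
Lemma OU_diag (S : R -> {linear H -> H}) (HS : C0_semigroup S) (Q : H -> H)
    (a : R -> H) (nu : R -> R -> H -> probability (borel H) R)
    (Hnu : OU_kernel dot S Q a nu) (t : R) (x : H) :
  0 <= t -> nu t t x (~` [set x]) = 0%E.
Proof.
move=> t0.
have [m [C [[_ _ dotm] bC gauss]]] : exists m : H, exists C : H -> H,
    [/\ bochner_integral dot t t (fun u => S (t - u) (a u)) m,
        forall v, bochner_integral dot 0 (t - t)
          (fun u => S u (Q (adjoint dot (S u) v))) (C v)
      & forall x, gaussian_measure dot (nu t t x) (S (t - t) x + m) C].
  by apply: Hnu; rewrite t0 lexx.
have marg v (B : set R) : measurable B -> nu t t x [set z | B (dot z v)] = \d_(dot x v) B.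
  move=> mB; have [_ _ dotC] := bC v.
  rewrite (gauss x v B mB) subrr (semigroup0 HS) (dotDl Hdot) dotm dotC subrr.
  by rewrite !set_itv1 !Rintegral_set1 addr0 /normal_law eqxx.
have [e eD] := separable_dense_seq Hsep.
rewrite (_ : ~` _ = \bigcup_j [set z | (~` [set dot x (e j)]) (dot z (e j))]).
  apply: measure_bigcup_null => j.
    rewrite -[X in measurable X]setTI; apply: (measurable_dot Hdot (e j)) => //.
    exact: measurableC.
  apply: (etrans (marg (e j) (~` [set dot x (e j)]) (measurableC (measurable_set1 _)))).
  by rewrite diracE memNset//= => /(_ erefl).
apply/seteqP; split=> z /=; last by move=> [j _ zj] zx; apply: zj; rewrite zx.
move=> zx; apply: contrapT => h; apply: zx.
apply/eqP; rewrite -subr_eq0 -normr_le0 (norm_le_dense Hdot eD)// => j.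
rewrite mul0r (dotBl Hdot) subr_le0.
have [->//|/eqP zj] := eqVneq (dot z (e j)) (dot x (e j)).
by exfalso; apply: h; exists j.
Qed.

Lemma integral_dirac_law (P : {measure set (borel H) -> \bar R}) (x : H) (f : H -> R) :
  P setT = 1%E -> P (~` [set x]) = 0%E -> measurable_fun [set: borel H] f ->
  \int[P]_z f z = f x.
Proof.
move=> P1 Px mf; rewrite /Rintegral.
rewrite (eq_measure_integral (\d_(x : borel H))); last by move=> A mA _; exact: dirac_law.
have mE : measurable_fun [set: borel H] (EFin \o f) by apply/measurable_EFinP.
by rewrite (integral_dirac _ measurableT mE) diracT mul1e.
Qed.

(** With s = t, the Markov identity on the event that X_t misses U shows that mu(X_t, U) vanishes
    almost surely there. This is applied to countably many balls; those missing X_t cover everything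
    except X_t. *)
Lemma markov_diag {d} {Omega : measurableType d} (P : probability Omega R)
    (Filt : R -> set (set Omega)) (X : R -> Omega -> H)
    (mu : R -> R -> R.-pker (borel H) ~> (borel H)) (t : R) :
  0 <= t -> (forall B : set (borel H), measurable B -> Filt t (X t @^-1` B)) ->
  Filt t `<=` measurable -> markov_transition P Filt X mu ->
  {ae P, forall w, mu t t (X t w) (~` [set X t w]) = 0%E}.
Proof.
move=> t0 XF Fm Hmu; have [e eD] := separable_dense_seq Hsep.
have mX : measurable_fun setT (X t : Omega -> borel H).
  by move=> _ B mB; rewrite setTI; exact/Fm/XF.
pose U j k : set (borel H) := ball (e j) (k.+1%:R^-1 : R).
have mU j k : measurable (U j k) by apply: borel_open; exact: ball_open.
have aeU j k : {ae P, forall w, ~ U j k (X t w) -> mu t t (X t w) (U j k) = 0%E}.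
  have FA : Filt t (X t @^-1` (~` U j k)) by apply: XF; exact: measurableC.
  have := @Hmu t t _ _ (U j k) FA (mU j k).
  rewrite t0 lexx preimage_setC setICl measure0 => /(_ isT)/esym int0.
  have mm : measurable_fun (~` X t @^-1` U j k) (fun w => mu t t (X t w) (U j k)).
    apply: measurable_funTS.
    exact: (measurableT_comp (measurable_kernel (mu t t) _ (mU j k)) mX).
  have mA : measurable (~` X t @^-1` U j k) by rewrite preimage_setC; exact: Fm.
  have : ae_eq P (~` X t @^-1` U j k) (fun w => mu t t (X t w) (U j k)) (cst 0%E).
    apply/(ae_eq_integral_abs P mA mm).
    by rewrite -int0; apply: eq_integral => w _; rewrite gee0_abs.
  by apply: filterS => w h /h.
have : {ae P, forall w, forall j k, ~ U j k (X t w) -> mu t t (X t w) (U j k) = 0%E}.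
  by apply: ae_foralln => j; exact: ae_foralln.
apply: filterS => w h.
pose V j k := if `[< U j k (X t w) >] then set0 else U j k.
rewrite (_ : ~` _ = \bigcup_j \bigcup_k V j k).
  have mV j k : measurable (V j k) by rewrite /V; case: ifP.
  apply: measure_bigcup_null => j; first by apply: bigcup_measurable.
  apply: measure_bigcup_null => k //.
  by rewrite /V; case: asboolP => // /h.
apply/seteqP; split=> z /=; last first.
  by move=> [j _ [k _]]; rewrite /V; case: asboolP => // UX Uz zX; apply: UX; rewrite -zX.
move=> /eqP; rewrite -subr_eq0 -normr_gt0 => zX.
(* A ball of this radius that contains [z] cannot also contain [X t w]. *)
have [k kz] : exists k, k.+1%:R^-1 < `|z - X t w| / 2.
  near \oo => k; exists k.
  near: k; apply: (near_infty_natSinv_lt (PosNum (divr_gt0 zX (ltr0n _ 2)))).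
have k0 : 0 < k.+1%:R^-1 :> R by rewrite invr_gt0.
have [j zj] := eD z _ k0.
exists j => //; exists k => //; rewrite /V; case: asboolP; rewrite /U -ball_normE/=.
  move=> ej; have := ler_normD (z - e j) (e j - X t w).
  rewrite subrKA; set N := `|z - X t w| in kz *.
  by move: kz zj ej => /=; set q := _^-1; set b := `|_|; set c := `|_|; lra.
by move=> _; rewrite distrC.
Unshelve. all: by end_near. Qed.

End dirac_laws.

(** * The transforms h and g *)

Section transforms.
Context {R : realType} {H : completeNormedModType R} {m : nat}.

Lemma gauss_density_ge0 (z b : 'cV[R]_m) (C : 'M[R]_m) : 0 <= gauss_density z b C.
Proof. by rewrite mulr_ge0 ?expR_ge0// invr_ge0 sqrtr_ge0. Qed.

Lemma measurable_gauss_density (L : {linear H -> 'cV[R]_m}) (Sigma : 'M[R]_m)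
    (z : 'cV[R]_m) : continuous L ->
  measurable_fun [set: borel H] (fun x => gauss_density z (L x) Sigma).
Proof.
move=> cL.
have mL i : measurable_fun [set: borel H] (fun x => L x i 0).
  apply: (continuous_borel_measurable (V := H)) => x.
  exact: (cvg_comp _ _ (cL x) (@coord_continuous R m 1 i 0 (L x))).
rewrite /gauss_density; apply: measurable_funM => //; apply: measurableT_comp => //.
apply: measurable_funM => //.
under eq_fun do rewrite mxE.
apply: measurable_sum => j; apply: measurable_funM; last first.
  under eq_fun do rewrite !mxE.
  exact: measurable_funB.
under eq_fun do rewrite mxE.
apply: measurable_sum => i; apply: measurable_funM => //.
under eq_fun do rewrite !mxE.
exact: measurable_funB.
Qed.

Variables (k : H -> 'cV[R]_m -> R) (n : nat) (tt : nat -> R) (y : nat -> 'cV[R]_m).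
Hypothesis k0 : forall x z, 0 <= k x z.
Hypothesis mk : forall z, measurable_fun [set: borel H] (fun x => k x z).

Lemma transform_ge0 (kappa : R -> R -> H -> {measure set (borel H) -> \bar R})
    (t : R) (x : H) : t != 0 -> 0 <= transform k n tt y kappa t x.
Proof.
move=> t0; rewrite /transform (negbTE t0) /transform_pos.
have l0 l : forall i z, 0 <= lookahead k tt y kappa l i z.
  elim: l => [//|l IH] i z /=.
  by apply: Rintegral_ge0 => u _; rewrite mulr_ge0.
by apply: Rintegral_ge0 => u _; rewrite mulr_ge0.
Qed.

Lemma measurable_obs_index j : measurable [set s | obs_index n tt s = j].
Proof.
rewrite /obs_index; elim: (iota 0 n.+1) j => [|i l IH] j /=.
  have [->|j0] := eqVneq 0%N j; first by rewrite (_ : mkset _ = setT)//; apply/seteqP.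
  rewrite (_ : mkset _ = set0)//; apply/seteqP; split => //= s /eqP.
  by rewrite (negbTE j0).
case: j => [|j].
  rewrite (_ : mkset _ = `]-oo, tt i]%classic); first exact: measurable_itv.
  by apply/seteqP; split => s; rewrite /= in_itv/=; case: ifP.
rewrite (_ : mkset _ = `]tt i, +oo[%classic `&`
    [set s | find (fun j => s <= tt j) l = j]).
  by apply: measurableI => //; exact: measurable_itv.
apply/seteqP; split => s; rewrite /= in_itv/= andbT; case: leP => // tis.
  by move=> [h]; split.
  by move=> [].
by move=> [_ ->].
Qed.

Variable T : R.
Hypothesis HT : tt n = T.

Lemma obs_index_le s : s <= T -> s <= tt (obs_index n tt s) /\ (obs_index n tt s <= n)%N.
Proof.
move=> sT; have hs : has (fun j => s <= tt j) (iota 0 n.+1).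
  by apply/hasP; exists n; rewrite ?mem_iota ?HT//= add0n ltnS leqnn.
have := nth_find 0%N hs; have := hs; rewrite has_find size_iota => jn.
by rewrite nth_iota// add0n => h; split.
Qed.

Hypothesis Htt : forall i, (i < n)%N -> tt i < tt i.+1.

Lemma obs_index_last : obs_index n tt T = n.
Proof.
have [+ jn] := obs_index_le (lexx T); set j := obs_index n tt T in jn *.
move=> Tj; apply/eqP; rewrite eqn_leq jn/= leqNgt; apply/negP => jlt.
suff : tt j < tt n by rewrite HT ltNge Tj.
have : forall l, (j < l)%N -> (l <= n)%N -> tt j < tt l.
  elim=> // l IH; rewrite ltnS leq_eqVlt => /predU1P[<-|jl] ln; first exact: Htt.
  by rewrite (lt_trans (IH jl (ltnW ln)))// Htt.
exact.
Qed.

Lemma transform_last (kappa : R -> R -> H -> {measure set (borel H) -> \bar R}) x :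
  T != 0 -> transform k n tt y kappa T x = \int[kappa T T x]_z k z (y n).
Proof.
move=> T0; rewrite /transform (negbTE T0) /transform_pos obs_index_last HT subnn/=.
by under eq_Rintegral do rewrite mulr1.
Qed.

Context {dot : H -> H -> R}.
Hypotheses (Hdot : inner_product dot) (Hsep : @separable R H).
Context {S : R -> {linear H -> H}} (HS : C0_semigroup S).
Context {Q : H -> H} {a : R -> H} {nu : R -> R -> H -> probability (borel H) R}.
Hypothesis Hnu : OU_kernel dot S Q a nu.
Hypothesis tt0 : tt 0%N = 0.

Let kappa := fun s t x => nu s t x : {measure set (borel H) -> \bar R}.

Lemma obs_times_ge0 i : (i <= n)%N -> 0 <= tt i.
Proof.
elim: i => [|i IH] ni; first by rewrite tt0.
by rewrite (le_trans (IH (ltnW ni)))// ltW// Htt.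
Qed.

(** Non-negativity is carried through the induction because kernel integrals are known to be
    measurable for non-negative integrands. *)
Lemma lookahead_OU l : forall i, (i + l <= n)%N ->
  measurable_fun [set: borel H] (lookahead k tt y kappa l i) /\
  forall x, 0 <= lookahead k tt y kappa l i x.
Proof.
elim: l => [|l IH] i il /=; first by split => //; exact: measurable_cst.
rewrite addnS -addSn in il; have [m1 l0] := IH _ il.
have i_n : (i < n)%N by rewrite (leq_trans _ il)// leq_addr.
split=> [|x]; last by apply: Rintegral_ge0 => z _; rewrite mulr_ge0.
suff h : measurable_fun [set: borel H] (fun x => \int[nu (tt i) (tt i.+1) x]_z
    (k z (y i.+1) * lookahead k tt y kappa l i.+1 z)%:E)%E.
  exact: (measurableT_comp (fine_measurable measurableT) h).
apply: (@measurable_fun_integral_kernel _ _ (borel H) (borel H) R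
  (fun x => nu (tt i) (tt i.+1) x) _
  (fun z => (k z (y i.+1) * lookahead k tt y kappa l i.+1 z)%:E)).
- move=> B mB; apply: (measurable_OU_space Hdot Hsep HS Hnu) => //.
  by rewrite obs_times_ge0 ?(ltnW i_n)// ltW// Htt.
- by move=> z; rewrite lee_fin mulr_ge0.
- by apply/measurable_EFinP; apply: measurable_funM.
Qed.

(** Between observations the index is constant and only the starting time of the first kernel moves;
    the finitely many pieces are glued. Time 0 is left out, the transform being defined there as a
    limit. *)
Lemma measurable_transform_OU x :
  measurable_fun `]0, T]%classic (fun s => transform k n tt y kappa s x).
Proof.
pose F j s := \int[nu (clamp (tt j) s) (tt j) x]_z
  (k z (y j) * lookahead k tt y kappa (n - j) j z).
apply: (eq_measurable_fun (fun s => F (obs_index n tt s) s)).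
  move=> s; rewrite inE/= in_itv/= => /andP[s0 sT].
  rewrite /F /transform gt_eqF// /transform_pos.
  have [sj _] := obs_index_le sT.
  suff -> : clamp (tt (obs_index n tt s)) s = s by [].
  by rewrite /clamp (min_idPl _)// (max_idPr _)// ltW.
apply: (@measurable_fun_glue _ _ R R _ (obs_index n tt) F) => j.
  by apply: measurableI => //; exact: measurable_obs_index.
have [jn|jn] := leqP j n; last first.
  rewrite (_ : _ `&` _ = set0); first exact: measurable_fun_set0.
  apply/seteqP; split => // s [/=]; rewrite in_itv/= => /andP[_ /obs_index_le[_ +]] sj.
  by rewrite sj leqNgt jn.
have [m1 l0] : measurable_fun [set: borel H] (lookahead k tt y kappa (n - j) j) /\
  forall x, 0 <= lookahead k tt y kappa (n - j) j x.
  by apply: lookahead_OU; rewrite subnKC.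
apply: measurable_funTS.
suff h : measurable_fun [set: R] (fun s => \int[nu (clamp (tt j) s) (tt j) x]_z
    (k z (y j) * lookahead k tt y kappa (n - j) j z)%:E)%E.
  exact: (measurableT_comp (fine_measurable measurableT) h).
apply: (@measurable_fun_integral_kernel _ _ R (borel H) R
  (fun s => nu (clamp (tt j) s) (tt j) x) _
  (fun z => (k z (y j) * lookahead k tt y kappa (n - j) j z)%:E)).
- move=> B mB; apply: (measurable_OU_time Hdot Hsep HS Hnu) => //.
  exact: obs_times_ge0.
- by move=> z; rewrite lee_fin mulr_ge0.
- by apply/measurable_EFinP; apply: measurable_funM.
Qed.

End transforms.

(** * Logarithmic gradients *)

Section log_gradient.
Context {R : realType} {H : completeNormedModType R} {dot : H -> H -> R}.
Hypotheses (Hdot : inner_product dot) (Hsep : @separable R H).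
Context {d : measure_display} {X : measurableType d}.

Lemma gradient_cvg (phi : H -> R) (x v u : H) : gradient dot phi x v ->
  k.+1%:R * (phi (k.+1%:R^-1 *: u + x) - phi x) @[k --> \oo] --> dot v u.
Proof.
move=> [dphi dE].
have := @diff_derivable _ _ _ _ _ u dphi => cphi.
have E : 'D_u phi x = dot v u.
  by rewrite deriveE// dE.
rewrite -E; have {}cphi : h^-1 *: ((phi \o shift x) (h *: u) - phi x) @[h --> 0^'] --> 'D_u phi x.
  exact: cphi.
have kcvg : (k.+1%:R^-1 : R) @[k --> \oo] --> 0^'.
  move=> A [r /= r0 rA].
  apply: filterS (near_infty_natSinv_lt (PosNum r0)) => k kr /=.
  by apply: rA => /=; rewrite ?invr_eq0// sub0r normrN ger0_norm.
have := cvg_comp _ _ kcvg cphi; apply: cvg_trans; apply: near_eq_cvg.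
by apply: nearW => k /=; rewrite invrK.
Qed.

(* The space argument is rounded to a dense sequence. *)
Lemma measurable_fun_rounding (I : set R) (l : R -> H -> R)
    (D : set X) (tau : X -> R) (Z : X -> borel H) :
  measurable I -> (forall z, measurable_fun I (l ^~ z)) ->
  (forall s, I s -> continuous (l s)) ->
  (forall p, D p -> I (tau p)) ->
  measurable D -> measurable_fun D tau -> measurable_fun D Z ->
  measurable_fun D (fun p => l (tau p) (Z p)).
Proof.
move=> mI ml cl DI mD mtau mZ; have [e eD] := separable_dense_seq Hsep.
have q0 k : 0 < (k.+1%:R^-1 : R) by rewrite invr_gt0.
have exj k p : exists j, `|(Z p : H) - e j| < k.+1%:R^-1 by exact: eD.
(* Taking the least admissible index makes the choice measurable: each level set of [N k] is one set
   [A j] minus the earlier ones. *)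
pose N k p := ex_minn (exj k p).
apply: (@measurable_fun_cvg _ _ _ _ (fun k p => l (tau p) (e (N k p)))).
  move=> k.
  have mN j : measurable (D `&` N k @^-1` [set j]).
    pose A i := D `&` Z @^-1` [set z : H | `|z - e i| < k.+1%:R^-1].
    have mA i : measurable (A i).
      apply: mZ => //; apply: borel_open.
      rewrite (_ : mkset _ = ball (e i) (k.+1%:R^-1 : R)); first exact: ball_open.
      by apply/seteqP; split=> z; rewrite -ball_normE/= distrC.
    rewrite (_ : _ `&` _ = A j `\` \big[setU/set0]_(i < j) A i).
      by apply: measurableD => //; exact: bigsetU_measurable.
    apply/seteqP; split=> p; rewrite -bigcup_mkord /=.
      move=> [Dp]; rewrite /N; case: ex_minnP => i Zi mini <-; split => //.
      by move=> [i' /= i'i [_ /mini]]; rewrite leqNgt i'i.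
    move=> [[Dp Zj] nA]; split=> //; rewrite /N; case: ex_minnP => i Zi mini.
    apply/eqP; rewrite eqn_leq mini// leqNgt; apply/negP => ij.
    by apply: nA; exists i.
  apply: (@measurable_fun_glue _ _ X R D (N k) (fun j p => l (tau p) (e j))) => // j.
  apply: (@measurable_comp _ _ _ X R R I (l ^~ (e j)) _ tau) => //.
    by move=> _ [p [Dp _] <-]; exact: DI.
  by apply: measurable_funS mtau => // p [].
move=> p Dp.
suff cvgZ : e (N k p) @[k --> \oo] --> (Z p : H).
  exact: (cvg_comp _ _ cvgZ (cl _ (DI _ Dp) (Z p))).
apply/cvgrPdist_lt => r r0; near=> k.
have : `|(Z p : H) - e (N k p)| < k.+1%:R^-1.
  by rewrite /N; case: ex_minnP.
move/lt_trans; apply.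
by near: k; exact: (near_infty_natSinv_lt (PosNum r0)).
Unshelve. all: by end_near. Qed.

(** The scalar product is the derivative of [l (tau p)] at [Z p] in the direction [F p], a limit of
    difference quotients in which [G] no longer appears. Differentiability supplies the spatial
    continuity needed for rounding. *)
Lemma measurable_dot_gradient (I : set R) (l : R -> H -> R) (G : R -> H -> H)
    (D : set X) (tau : X -> R) (Z F : X -> borel H) :
  measurable I -> (forall z, measurable_fun I (l ^~ z)) ->
  (forall s, I s -> forall x, gradient dot (l s) x (G s x)) ->
  (forall p, D p -> I (tau p)) ->
  measurable D -> measurable_fun D tau -> measurable_fun D Z ->
  measurable_fun D F ->
  measurable_fun D (fun p => dot (F p) (G (tau p) (Z p))).
Proof.
move=> mI ml lG DI mD mtau mZ mF.
have cl s : I s -> continuous (l s).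
  move=> Is x; apply: differentiable_continuous.
  by have [] := lG s Is x.
apply: (@measurable_fun_cvg _ _ _ _ (fun k p =>
  k.+1%:R * (l (tau p) (k.+1%:R^-1 *: (F p : H) + (Z p : H)) - l (tau p) (Z p)))).
  move=> k; apply: measurable_funM => //; apply: measurable_funB.
    apply: (measurable_fun_rounding (Z := fun p => k.+1%:R^-1 *: (F p : H) + (Z p : H))
      mI ml cl DI) => //.
    by apply: (measurable_funHD Hdot Hsep) => //; exact: (measurable_funHZ Hdot Hsep).
  exact: (measurable_fun_rounding mI ml cl DI).
move=> p Dp; rewrite (dot_sym Hdot).
by apply: gradient_cvg; exact: lG (DI p Dp) _.
Qed.

End log_gradient.

(** * Functionals on the path space *)

Section paths.
Context {R : realType} {H : completeNormedModType R} {dot : H -> H -> R}.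
Hypotheses (Hdot : inner_product dot) (Hsep : @separable R H).
Context {T : R}.
Implicit Types x : path_space H T.

Lemma path_atE x (t : set_type `[0, T]) :
  path_at x (set_val t) = (x : continuousType (set_type `[0, T]) H) t.
Proof. exact: (congr1 (@^~ t) (valLK 0 _)). Qed.

(** The topology is initial for the inclusion into all functions with uniform convergence, which
    implies convergence at each point. *)
Lemma path_eval_continuous (t : set_type `[0, T]) :
  continuous (fun x : path_space H T => (x : continuousType (set_type `[0, T]) H) t).
Proof.
move=> x.
pose i (x : path_space H T) : arrow_uniform_type (set_type `[0, T]) H :=
  (x : continuousType (set_type `[0, T]) H).
have ci : i @ x --> i x by exact: initial_continuous.
apply: (cvg_comp i (fun f => f t) ci).
move=> W; rewrite -nbhs_entourageE => -[E entE EW].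
apply: (@filterS _ (nbhs (i x)) _ [set g | forall t, E (i x t, g t)]).
  by move=> g /= Eg; apply: EW; apply/xsectionP; exact: Eg.
have FF : Filter (nbhs (i x)) by exact: nbhs_filter.
by have /(cvg_fct_entourageP FF) := @cvg_id _ (nbhs (i x)); apply.
Qed.

Lemma measurable_path_at (s : R) : 0 <= s <= T ->
  measurable_fun [set: borel (path_space H T)] (fun x => path_at x s : borel H).
Proof.
move=> sT; have sT' : s \in (`[0, T]%classic : set R) by rewrite inE/= in_itv.
pose t : set_type `[0, T] := SigSub sT'.
rewrite (_ : (fun _ => _) = fun x : path_space H T =>
    (x : continuousType (set_type `[0, T]) H) t); last first.
  by apply/funext => x; rewrite -path_atE.
move=> mT; suff h : preimage_set_system setT (fun x : path_space H T =>
    (x : continuousType (set_type `[0, T]) H) t : borel H) (@open H) `<=`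
    @measurable _ (borel (path_space H T)).
  exact: (@measurability _ _ (borel (path_space H T)) (borel H) setT _ (@open H) erefl h mT).
move=> _ [U oU <-]; rewrite setTI; apply: sub_sigma_algebra.
by have /continuousP := @path_eval_continuous t; apply.
Qed.

Lemma cvg_path_at x (s : R) (r : R^nat) : 0 <= s <= T ->
  (forall k, 0 <= r k <= T) -> r k @[k --> \oo] --> s ->
  path_at x (r k) @[k --> \oo] --> path_at x s.
Proof.
move=> sT rT rs.
have sT' : s \in (`[0, T]%classic : set R) by rewrite inE/= in_itv.
have rT' k : r k \in (`[0, T]%classic : set R) by rewrite inE/= in_itv rT.
pose t : set_type `[0, T] := SigSub sT'.
pose u k : set_type `[0, T] := SigSub (rT' k).
rewrite (_ : (fun k => _) = fun k => (x : continuousType (set_type `[0, T]) H) (u k));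
  last by apply/funext => k; rewrite -path_atE.
rewrite -[s]/(set_val t) path_atE.
have cx : continuous (x : continuousType (set_type `[0, T]) H) by exact: cts_fun.
apply: (cvg_comp u (x : continuousType (set_type `[0, T]) H)); last exact: cx.
move=> W [/= _ [[V oV <-] /= Vt] VW].
have : \forall k \near \oo, V (r k) by apply: rs; exact: open_nbhs_nbhs.
by apply: filterS => k Vrk; exact: VW.
Qed.

(** Tested against [v], this is a Caratheodory function: continuous in time along each path, and
    measurable in the path at each time because evaluation is. *)
Lemma measurable_path_process (f : R -> H -> H) :
  {within [set p : R * H | 0 <= p.1], continuous (fun p => f p.1 p.2)} ->
  measurable_fun [set p : R * borel (path_space H T) | 0 <= p.1 <= T]
    (fun p => f p.1 (path_at p.2 p.1) : borel H).
Proof.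
move=> cf; apply: (measurable_fun_dot Hdot Hsep) => v.
have cf' (s : R) (z : H) (r : nat -> R) (w : nat -> H) : 0 <= s -> (forall k, 0 <= r k) ->
    r k @[k --> \oo] --> s -> w k @[k --> \oo] --> z ->
    f (r k) (w k) @[k --> \oo] --> f s z.
  move=> s0 r0 rs wz; have /subspace_continuousP/(_ (s, z) s0) c := cf.
  apply: (cvg_comp (fun k => (r k, w k)) (fun p => f p.1 p.2) _ c).
  have rwsz : (r k, w k) @[k --> \oo] --> (s, z).
    move=> W [[A B] [/= sA zB] AB].
    have rA : \forall k \near \oo, A (r k) := rs _ sA.
    have wB : \forall k \near \oo, B (w k) := wz _ zB.
    by apply: filterS2 rA wB => k Ak Bk; exact: (AB (r k, w k)).
  move=> W Wsz.
  have h : \forall k \near \oo, 0 <= r k -> W (r k, w k) := rwsz _ Wsz.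
  by apply: (filterS _ h) => k; exact.
have cfs (s : R) : 0 <= s -> continuous (f s).
  move=> s0 z; have /subspace_continuousP/(_ (s, z) s0) c := cf.
  apply: (cvg_comp (fun z => (s, z)) (fun p => f p.1 p.2) _ c).
  have sz : (s, z') @[z' --> z] --> (s, z).
    move=> W [[A B] [/= sA zB] AB].
    by apply: filterS zB => z' Bz'; apply: (AB (s, z')); split => //; exact: nbhs_singleton.
  move=> W Wsz.
  have h : \forall z' \near z, 0 <= s -> W (s, z') := sz _ Wsz.
  by apply: (filterS _ h) => z'; exact.
have grid_itv k s : 0 <= s <= T -> 0 <= grid k s <= T.
  by move=> /andP[s0 sT]; rewrite grid_ge0 (le_trans (grid_le _ s0)).
apply: (@measurable_fun_caratheodory R _ (borel (path_space H T)) T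
  (fun s x => dot (f s (path_at x s)) v)).
- move=> s sT; have /andP[s0 _] := sT.
  have mf : measurable_fun [set: borel H] (fun z => dot (f s z) v).
    apply: (continuous_borel_measurable (V := H)) => z.
    exact: (cvg_comp _ _ (cfs s s0 z) (@dot_continuous _ _ _ Hdot v (f s z))).
  exact: (measurableT_comp mf (measurable_path_at sT)).
- move=> s x sT; have /andP[s0 _] := sT.
  suff c : f (grid k s) (path_at x (grid k s)) @[k --> \oo] --> f s (path_at x s).
    exact: (cvg_comp _ _ c (@dot_continuous _ _ _ Hdot v (f s (path_at x s)))).
  apply: cf' => //; [by move=> k; exact: grid_ge0|exact: cvg_grid|].
  apply: cvg_path_at => //; last exact: cvg_grid.
  by move=> k; exact: grid_itv.
Qed.

Lemma measurable_path_integral (F G : R -> H -> H) (l : R -> H -> R) :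
  {within [set p : R * H | 0 <= p.1], continuous (fun p => F p.1 p.2)} ->
  (forall z, measurable_fun `]0, T]%classic (l ^~ z)) ->
  (forall s z, 0 < s <= T -> gradient dot (l s) z (G s z)) ->
  measurable_fun [set: borel (path_space H T)] (fun x =>
    \int[lebesgue_measure]_(s in `[0, T]) dot (F s (path_at x s)) (G s (path_at x s))).
Proof.
move=> cF ml lG.
pose D := [set p : R * borel (path_space H T) | 0 < p.1 <= T].
have mD : measurable D.
  rewrite (_ : D = fst @^-1` `]0, T]%classic).
    by rewrite -[X in measurable X]setTI; exact: measurable_fst.
  by apply/seteqP; split=> p; rewrite /D/= in_itv.
have DS : D `<=` [set p : R * borel (path_space H T) | 0 <= p.1 <= T].
  by move=> p /andP[/ltW/= -> ->].
have mS : measurable [set p : R * borel (path_space H T) | 0 <= p.1 <= T].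
  rewrite (_ : mkset _ = fst @^-1` `[0, T]%classic).
    by rewrite -[X in measurable X]setTI; exact: measurable_fst.
  by apply/seteqP; split=> p; rewrite /= in_itv.
have mZ : measurable_fun D (fun p => path_at p.2 p.1 : borel H).
  apply: (measurable_funS mS DS); apply: (measurable_path_process (f := fun _ z => z)).
  apply: continuous_subspaceT => p; exact: cvg_snd.
have mFZ : measurable_fun D (fun p => F p.1 (path_at p.2 p.1) : borel H).
  by apply: (measurable_funS mS DS); exact: measurable_path_process.
have mPhi := @measurable_dot_gradient _ _ _ Hdot Hsep _ _ `]0, T]%classic l G D fst _ _
  (measurable_itv _) ml _ _ mD (measurable_funTS measurable_fst) mZ mFZ.
have {}mPhi : measurable_fun D (fun p =>
    dot (F p.1 (path_at p.2 p.1)) (G p.1 (path_at p.2 p.1))).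
  apply: mPhi => [s|p]; rewrite /= in_itv//= => sT x.
  exact: lG.
pose A := [set q : borel (path_space H T) * R | 0 < q.2 <= T].
have mA : measurable A.
  rewrite (_ : A = snd @^-1` `]0, T]%classic).
    by rewrite -[X in measurable X]setTI; exact: measurable_snd.
  by apply/seteqP; split=> p; rewrite /A/= in_itv.
pose psi (q : borel (path_space H T) * R) :=
  dot (F q.2 (path_at q.1 q.2)) (G q.2 (path_at q.1 q.2)).
have mpsi : measurable_fun A psi.
  apply: (@measurable_comp _ _ _ _ _ _ D (fun p =>
    dot (F p.1 (path_at p.2 p.1)) (G p.1 (path_at p.2 p.1))) _ (fun q => (q.2, q.1))) => //.
    by move=> _ [q Aq <-].
  apply: measurable_funTS; apply/measurable_fun_pairP.
  by split; [exact: measurable_snd|exact: measurable_fst].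
have := measurable_Rintegral_param mA mpsi.
apply: eq_measurable_fun => x _; rewrite /Rintegral; congr fine.
have -> : xsection A x = `]0, T]%classic.
  by rewrite set_itvoc; apply/seteqP; split=> s; rewrite /xsection/= !inE.
(* The gradient is controlled only for positive times; the endpoint 0 is a null set and is added
   back here. *)
rewrite integral_itv_obnd_cbnd//; apply/measurable_EFinP.
apply: (@measurable_comp _ _ _ _ _ _ A psi _ (fun s => (x, s))) => //.
  by move=> _ [s sT <-]; move: sT; rewrite /= in_itv.
apply: measurable_funTS; apply/measurable_fun_pairP.
by split; [exact: measurable_cst|exact: measurable_id].
Qed.

End paths.

(** * Change of measure *)

Section density.
Local Open Scope ereal_scope.
Import HBNNSimple.
Context {R : realType} {d d'} {Omega : measurableType d} {Y : measurableType d'}.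
Variables (P : {measure set Omega -> \bar R}) (nu : {measure set Y -> \bar R}).
Variables (X : Omega -> Y) (E : Omega -> R).
Hypotheses (mX : measurable_fun setT X) (mE : measurable_fun setT E).
Hypothesis E0 : forall w, (0 <= E w)%R.
Hypothesis nuE : forall B, measurable B -> nu B = \int[P]_(w in X @^-1` B) (E w)%:E.

Let mXB B : measurable B -> measurable (X @^-1` B).
Proof. by move=> mB; rewrite -[X in measurable X]setTI; exact: mX. Qed.

Let integral_density_nnsfun (f : {nnsfun Y >-> R}) :
  \int[nu]_y (f y)%:E = \int[P]_w ((f (X w))%:E * (E w)%:E).
Proof.
rewrite integralT_nnsfun sintegralE.
under [RHS]eq_integral.
  move=> w _; rewrite fimfunE -fsumEFin// ge0_mule_fsuml; last first.
    by move=> r; rewrite nnfun_muleindic_ge0.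
  over.
rewrite /= ge0_integral_fsum//; last 2 first.
- move=> r; apply: emeasurable_funM; last exact/measurable_EFinP.
  apply/measurable_EFinP; apply: measurable_funM => //.
  have mi : measurable_fun setT (\1_(f @^-1` [set r]) : Y -> R).
    by apply: measurable_indic.
  exact: (measurableT_comp mi mX).
- by move=> r w _; rewrite mule_ge0//; [rewrite EFinM nnfun_muleindic_ge0|rewrite lee_fin].
apply: eq_fsbigr => r _.
under [RHS]eq_integral do rewrite EFinM -muleA.
have [r0|r0] := leP 0%R r; last first.
  rewrite preimage10 ?measure0 ?mule0.
    by rewrite integral0_eq// => w _; rewrite indic0 mul0e mule0.
  by move=> [y _ fy]; move: r0; rewrite -fy ltNge fun_ge0.
rewrite ge0_integralZl_EFin//.
- rewrite nuE//; congr (_ * _); rewrite integral_mkcond; apply: eq_integral => w _.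
  rewrite /patch indicE; have [h|h] := pselect (f (X w) = r).
    by rewrite !mem_set// mul1e.
  by rewrite !memNset// mul0e.
- by move=> w _; rewrite mule_ge0// lee_fin.
- apply: emeasurable_funM; apply/measurable_EFinP => //.
  have mi : measurable_fun setT (\1_(f @^-1` [set r]) : Y -> R).
    by apply: measurable_indic.
  exact: (measurableT_comp mi mX).
Qed.

(** Simple functions first, then monotone convergence on both sides. The law enters through [nuE],
    directly in terms of [P], because the weighted measures live only on the smaller sigma-algebra
    F_T. *)
Lemma integral_density_pushforward (f : Y -> \bar R) (B : set Y) :
  measurable B -> measurable_fun setT f -> (forall y, 0 <= f y) ->
  \int[nu]_(y in B) f y = \int[P]_(w in X @^-1` B) (f (X w) * (E w)%:E).
Proof.
move=> mB mf f0.
rewrite integral_mkcond [RHS]integral_mkcond.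
pose g := f \_ B.
have mg : measurable_fun setT g by apply/(measurable_restrictT _ mB)/measurable_funTS.
have g0 y : 0 <= g y by rewrite /g/patch; case: ifP.
transitivity (\int[P]_w (g (X w) * (E w)%:E)); last first.
  apply: eq_integral => w _; rewrite /g /patch.
  have [h|h] := pselect (B (X w)); first by rewrite !mem_set.
  by rewrite !memNset// mul0e.
pose f_ := nnsfun_approx measurableT mg.
have c1 : \int[nu]_y (f_ n y)%:E @[n --> \oo] --> \int[nu]_y g y.
  rewrite [X in _ --> X](_ : _ = \int[nu]_y limn (fun n => (f_ n y)%:E)).
    apply: cvg_monotone_convergence => //.
    - by move=> n; exact/measurable_EFinP.
    - by move=> n x _; rewrite lee_fin.
    - by move=> t _ n m nm; rewrite lee_fin; apply/lefP/nd_nnsfun_approx.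
  by apply: eq_integral => t _; apply/esym/cvg_lim => //; exact: cvg_nnsfun_approx.
have c2 : \int[P]_w ((f_ n (X w))%:E * (E w)%:E) @[n --> \oo] -->
    \int[P]_w (g (X w) * (E w)%:E).
  rewrite [X in _ --> X](_ : _ = \int[P]_w limn (fun n => (f_ n (X w))%:E * (E w)%:E)).
    apply: cvg_monotone_convergence => //.
    - move=> n; apply: emeasurable_funM; apply/measurable_EFinP => //.
      exact: measurableT_comp.
    - by move=> n x _; rewrite mule_ge0// lee_fin.
    - move=> t _ n m nm; rewrite lee_wpmul2r// lee_fin//.
      by apply/lefP/nd_nnsfun_approx.
  apply: eq_integral => t _; apply/esym/cvg_lim => //.
  by apply: cvgeZr => //; exact: cvg_nnsfun_approx.
have c3 : \int[nu]_y (f_ n y)%:E @[n --> \oo] --> \int[P]_w (g (X w) * (E w)%:E).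
  by under eq_fun do rewrite integral_density_nnsfun.
exact: (cvg_unique _ c1 c3).
Qed.

End density.

Lemma predictable_adapted {R : realType} {H : completeNormedModType R}
    {d : measure_display} {Omega : measurableType d} (Filt : R -> set (set Omega))
    (X : R -> Omega -> H) : filtration Filt -> predictable Filt X ->
  forall (t : R) (B : set (borel H)), 0 <= t -> measurable B -> Filt t (X t @^-1` B).
Proof.
move=> HF HX t B t0 mB.
have [F0 FC FU] := filtration_sigma HF t0.
rewrite (_ : X t @^-1` B =
    [set w | [set p : R * Omega | 0 <= p.1 /\ B (X p.1 p.2)] (t, w)]); last first.
  by apply/seteqP; split => w /=; [move=> ?; split|case].
(* The sets whose section at time [t] lies in F_t form a sigma-algebra; a generating rectangle has
   section either empty or its base event. *)
apply: (HX B mB [set E | Filt t [set w | E (t, w)]]); split.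
- split => [|E FE|E FE].
  + exact: F0.
  + have := FC _ FE; congr (Filt t _).
    by apply/seteqP; split => w /= [].
  + have := FU _ FE; congr (Filt t _).
- move=> E [[s [u [A [s0 su FA ->]]]]|[A [FA ->]]] /=.
  + have [/andP[st tu]|stu] := boolP (s < t <= u); last first.
      by have := F0; congr (Filt t _); apply/seteqP; split => // w [].
    have : Filt t A by apply: filtration_homo FA => //; rewrite s0 ltW.
    by congr (Filt t _); apply/seteqP; split => w /=; [split|case].
  + have [tE|/eqP tE] := eqVneq t 0; last first.
      by have := F0; congr (Filt t _); apply/seteqP; split => // w [].
    have := FA; rewrite -tE.
    by congr (Filt t _); apply/seteqP; split => w /=; [split|case].
Qed.

(** Yields positivity of C^h and C^g from the mean-one property: for [c <= 0] the inverse is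
    non-positive, also at c = 0 where it is 0, and the mean could not be 1. *)
Lemma expectation1_gt0 {R : realType} {d} {Omega : measurableType d}
    (P : probability Omega R) (c : R) (f : Omega -> R) :
  (forall w, 0 <= f w) -> ('E_P[fun w => (c^-1 * f w)%R] = 1)%E -> 0 < c.
Proof.
move=> f0 E1; rewrite ltNge; apply/negP => c0.
have : (0 <= - ('E_P[fun w => (c^-1 * f w)%R]))%E.
  rewrite unlock; have h w : (0 <= (- c^-1 * f w)%R%:E)%E.
    by rewrite lee_fin mulr_ge0// oppr_ge0 invr_le0.
  rewrite (eq_integral (fun w => - (- c^-1 * f w)%R%:E)%E).
    by rewrite integral_ge0N// oppeK; exact: integral_ge0.
  by move=> w _; rewrite -EFinN mulNr opprK.
by rewrite E1 leeNr oppe0 lee_fin ler10.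
Qed.

(** Uniqueness of the derivative: it has the same integral as [f] over every measurable set. *)
Lemma Radon_Nikodym_density {R : realType} {d} {T : measurableType d}
    (nu mu : probability T R) (f : T -> \bar R) : measurable_fun setT f ->
  (forall A, measurable A -> nu A = (\int[mu]_(x in A) f x)%E) ->
  nu `<< mu /\ ae_eq mu setT ('d (charge_of_finite_measure nu) '/d mu) f.
Proof.
move=> mf nuE.
have numu : nu `<< mu.
  move=> A A0 C mC CA; rewrite nuE// null_set_integral//.
  - exact: measurable_funTS.
  - exact: A0.
split => //; apply: integral_ae_eq => //; first exact: Radon_Nikodym_integrable.
by move=> A _ mA; rewrite -Radon_Nikodym_integral//; exact: nuE.
Qed.

Theorem mainTheorem4
  (R : realType) (H : completeNormedModType R) (dot : H -> H -> R)
  (Hdot : inner_product dot) (Hsep : @separable R H)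
  (* the equation *)
  (S : R -> {linear H -> H}) (DA : set H) (A : H -> H)
  (HS : C0_semigroup S) (HA : generator DA A S)
  (F : R -> H -> H)
  (HF : {within [set p : R * H | 0 <= p.1], continuous (fun p => F p.1 p.2)})
  (Q Qh : {linear H -> H})
  (HQb : continuous Q) (HQ : symmetric_positive dot Q)
  (HQtr : trace_class_positive dot Q)
  (HQhb : continuous Qh) (HQh : symmetric_positive dot Qh)
  (HQhQ : forall x, Qh (Qh x) = Q x)
  (d : measure_display) (Omega : measurableType d) (P : probability Omega R)
  (Filt : R -> set (set Omega)) (HFilt : filtration Filt)
  (W : R -> H -> Omega -> R) (HW : cylindrical_wiener P Filt W)
  (mu0 : probability (borel H) R)
  (X : R -> Omega -> H)
  (HX : mild_solution dot P Filt S F Qh W X)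
  (HX0 : forall B : set (borel H), measurable B -> P (X 0 @^-1` B) = mu0 B)
  (HXuniq : forall Y, mild_solution dot P Filt S F Qh W Y ->
     {ae P, forall w, Y 0 w = X 0 w} ->
     forall t, 0 <= t -> {ae P, forall w, Y t w = X t w})
  (mu : R -> R -> R.-pker (borel H) ~> (borel H))
  (Hmu : markov_transition P Filt X mu)
  (* the observations *)
  (T : R) (n : nat) (tt : nat -> R)
  (Hn : (0 < n)%N) (Htt0 : tt 0%N = 0)
  (Htt : forall i, (i < n)%N -> tt i < tt i.+1) (HttT : tt n = T)
  (m : nat) (L : {linear H -> 'cV[R]_m}) (HL : continuous L)
  (Sigma : 'M[R]_m) (HSigma : spd Sigma) (y : nat -> 'cV[R]_m)
  (* the auxiliary kernel *)
  (a : R -> H)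
  (Ham : measurable_fun (`[0, +oo[ : set R) (a : R -> borel H))
  (Hai : forall t, 0 <= t ->
     lebesgue_measure.-integrable `[0, t] (fun u : R => (`|a u|)%:E))
  (nu : R -> R -> H -> probability (borel H) R)
  (Hnu : OU_kernel dot S Q a nu) :
  let k := fun (x : H) (z : 'cV[R]_m) => gauss_density z (L x) Sigma in
  let h := transform k n tt y (fun s t x => mu s t x) in
  let g := transform k n tt y (fun s t x => nu s t x) in
  forall (G : R -> H -> H)
    (HG : forall t x, 0 < t <= T ->
       gradient dot (fun z => ln (g t z)) x (G t x)),
  let Ch := norm_const X P h in
  let Cg := norm_const X P g in
  let Eh := weight_h k n tt y X Ch h in
  let Eg := weight_g k n tt y X dot F G Cg g in
  forall (HEh : density_process P Filt T Eh)
    (HEg : density_process P Filt T Eg)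
    (Ph Pg : probability (g_sigma_algebraType (Filt T)) R)
    (HPh : has_density P Eh Ph) (HPg : has_density P Eg Pg)
    (* the random path, an F_T-measurable map into C([0,T];H) *)
    (Xpath : {mfun g_sigma_algebraType (Filt T) >-> borel (path_space H T)})
    (HXpath : {ae P, forall w, forall s, s \in `[0, T] ->
       path_at (Xpath w) s = X s w}),
  let Lh := distribution Ph Xpath in
  let Lg := distribution Pg Xpath in
  Lh `<< Lg /\
  ae_eq Lg setT ('d (charge_of_finite_measure Lh) '/d Lg)
    (fun x => (Cg / Ch *
       expR (\int[lebesgue_measure]_(s in `[0, T])
               dot (F s (path_at x s)) (G s (path_at x s))))%:E).
Proof.
move=> k h g G HG Ch Cg Eh Eg HEh HEg Ph Pg HPh HPg Xpath HXpath Lh Lg.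
have T0 : 0 < T.
  have := obs_times_ge0 Htt Htt0 (leq_pred n); rewrite -HttT.
  by move/le_lt_trans; apply; have := Htt n.-1; rewrite prednK//; apply.
have T0' : 0 <= T <= T by rewrite ltW//=.
have Tge0 := ltW T0.
have k0 x z : 0 <= k x z by exact: gauss_density_ge0.
have mk z : measurable_fun [set: borel H] (fun x => k x z).
  exact: measurable_gauss_density.
have gT x : g T x = k x (y n).
  rewrite /g (transform_last _ _ HttT Htt) ?gt_eqF//.
  apply: integral_dirac_law => //.
    exact: (@probability_setT _ _ _ (nu T T x)).
  exact: (OU_diag Hdot Hsep HS Hnu).
have XF t (B : set (borel H)) : 0 <= t -> measurable B -> Filt t (X t @^-1` B).
  exact: (predictable_adapted HFilt (mild_predictable HX)).
(* The Markov property determines [mu] only up to null sets along X, so this identity is almost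
   sure, whereas [gT] holds at every point. *)
have hT : {ae P, forall w, h T (X T w) = k (X T w) (y n)}.
  have := markov_diag Hsep Tge0 (fun B => XF T B Tge0) (filtration_sub HFilt Tge0) Hmu.
  apply: filterS => w Pw; rewrite /h (transform_last _ _ HttT Htt) ?gt_eqF//.
  by apply: integral_dirac_law => //; exact: prob_kernel.
have [[EhF _ _] _ Eh1] := HEh; have [[EgF _ _] _ Eg1] := HEg.
have FT : Filt T `<=` measurable := filtration_sub HFilt Tge0.
have mEh : measurable_fun setT (Eh T).
  by move=> _ B mB; rewrite setTI; exact/FT/EhF.
have mEg : measurable_fun setT (Eg T).
  by move=> _ B mB; rewrite setTI; exact/FT/EgF.
have g0 x : 0 <= g T x by rewrite gT.
have h0 x : 0 <= h T x by apply: transform_ge0; rewrite ?gt_eqF.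
pose pr w := \prod_(1 <= j < obs_index n tt T) k (X (tt j) w) (y j).
have pr0 w : 0 <= pr w by apply: prodr_ge0.
pose I w := \int[lebesgue_measure]_(s in `[0, T]) dot (F s (X s w)) (G s (X s w)).
have Ch0 : 0 < Ch.
  apply: (@expectation1_gt0 _ _ _ P _ (fun w => pr w * h T (X T w))).
    by move=> w; rewrite mulr_ge0.
  by under eq_fun do rewrite mulrA; exact: Eh1.
have Cg0 : 0 < Cg.
  apply: (@expectation1_gt0 _ _ _ P _ (fun w => pr w * g T (X T w) * expR (- I w))).
    by move=> w; rewrite !mulr_ge0// expR_ge0.
  by under eq_fun do rewrite !mulrA; exact: Eg1.
have Eg0 w : 0 <= Eg T w.
  have Ci : 0 <= Cg^-1 by rewrite invr_ge0 ltW.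
  exact: (mulr_ge0 (mulr_ge0 (mulr_ge0 Ci (pr0 w)) (g0 _)) (expR_ge0 _)).
have Eh0 w : 0 <= Eh T w.
  have Ci : 0 <= Ch^-1 by rewrite invr_ge0 ltW.
  exact: (mulr_ge0 (mulr_ge0 Ci (pr0 w)) (h0 _)).
pose J (x : path_space H T) := \int[lebesgue_measure]_(s in `[0, T])
  dot (F s (path_at x s)) (G s (path_at x s)).
have mJ : measurable_fun [set: borel (path_space H T)] J.
  apply: (measurable_path_integral (l := fun s z => ln (g s z)) Hdot Hsep HF) => //.
  move=> z; apply: (measurableT_comp (@measurable_ln R)).
  exact: (measurable_transform_OU y k0 mk HttT Htt Hdot Hsep HS Hnu Htt0 z).
pose phi (x : path_space H T) : \bar R := (Cg / Ch * expR (J x))%:E.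
have mphi : measurable_fun [set: borel (path_space H T)] phi.
  apply/measurable_EFinP; apply: measurable_funM => //.
  exact: (measurableT_comp (@measurable_expR R)).
have phi0 x : (0 <= phi x)%E.
  by rewrite lee_fin mulr_ge0 ?expR_ge0// divr_ge0 ?ltW.
have Xpre (B : set (borel (path_space H T))) : measurable B -> Filt T (Xpath @^-1` B).
  (* [Xpath] is measurable for the sigma-algebra generated by F_T, which is F_T itself. *)
  move=> mB; have sF (C : set Omega) : <<s Filt T >> C -> Filt T C.
    by rewrite (sigma_algebra_id (filtration_sigma HFilt Tge0)).
  apply: sF.
  by have := measurable_funP Xpath measurableT B mB; rewrite setTI.
have mX : measurable_fun [set: Omega] (Xpath : Omega -> borel (path_space H T)).
  by move=> _ B mB; rewrite setTI; exact/FT/Xpre.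
apply: Radon_Nikodym_density => // B mB.
have LhE : Lh B = (\int[P]_(w in Xpath @^-1` B) (Eh T w)%:E)%E := HPh _ (Xpre _ mB).
have LgE A' : measurable A' ->
    Lg A' = (\int[P]_(w in Xpath @^-1` A') (Eg T w)%:E)%E.
  by move=> mA'; exact: HPg _ (Xpre _ mA').
apply: (etrans LhE).
apply: (etrans _ (esym (integral_density_pushforward mX mEg Eg0 LgE mB mphi phi0))).
(* Both sides are integrals under [P] over the same event, so an almost sure comparison of
   integrands remains. *)
apply: ge0_ae_eq_integral.
- exact/FT/Xpre.
- exact/measurable_EFinP/measurable_funTS.
- apply: measurable_funTS; apply: emeasurable_funM; last exact/measurable_EFinP.
  exact: (measurableT_comp mphi mX).
- by move=> w _; rewrite lee_fin.
- by move=> w _; rewrite mule_ge0// lee_fin.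
apply: filterS2 hT HXpath => w hw Xw _.
have -> : phi (Xpath w) = (Cg / Ch * expR (I w))%:E.
  rewrite /phi /J /I; congr (_ * expR _)%:E; apply: eq_Rintegral => s sT.
  by rewrite inE/= in sT; rewrite Xw.
(* Both weights now share the product [pr w] and the factor [k (X T w) (y n)]; the two exponentials
   cancel and so does [Cg]. *)
rewrite -EFinM; congr EFin; rewrite /Eh /Eg /weight_h /weight_g -/(I w) -/(pr w).
rewrite hw gT expRN.
by field; rewrite ?gt_eqF ?expR_gt0.
Qed.
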